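(* Let $q\in H^{-1}_{per}(\mathbb{R},\mathbb{R})$ with $\widehat{q}(0)=0$, and let $Q$ be the associated real $1$-periodic function in $L_{2,per}(\mathbb{R})$ with $Q'=q$ (defined in the context). Then the maximal quasi-differential operator $S_{max}(q)$ on $L_2(\mathbb{R})$, given by $$S_{max}(q)u:=l_Q[u]=-(u'-Qu)'-Q(u'-Qu)-Q^2u,$$ $$\mathrm{Dom}(S_{max}(q)):=\{u\in L_2(\mathbb{R}) : u,\ u'-Qu\in W^1_{1,loc}(\mathbb{R}),\ l_Q[u]\in L_2(\mathbb{R})\},$$ is self-adjoint.
   Context: $H^{-1}_{per}(\mathbb{R},\mathbb{R})$ denotes the space of real-valued $1$-periodic distributions $q=\sum_{k\in 2\mathbb{Z}}\widehat{q}(k)e^{ik\pi x}$ with $\sum_{k\in2\mathbb{Z}}(1+|k|)^{-2}|\widehat{q}(k)|^2<\infty$ and $\widehat{q}(k)=\overline{\widehat{q}(-k)}$ for all $k\in2\mathbb{Z}$. Standing assumption of the paper: $\widehat{q}(0)=0$. Then $Q(x):=\sum_{k\in 2\mathbb{Z}\setminus\{0\}}\frac{\widehat{q}(k)}{ik\pi}e^{ik\pi x}$ is a real-valued $1$-periodic function in $L_2$ on a period with $\langle q,\varphi\rangle=-\langle Q,\varphi'\rangle$ for all $\varphi\in C^\infty_{comp}(\mathbb{R})$, i.e. $Q'=q$ in the sense of distributions. $W^1_{1,loc}(\mathbb{R})$ is the space of locally absolutely continuous functions. *)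

(* Defs.v *)
From HB Require Import structures.
From mathcomp Require Import all_boot all_order all_algebra.
From mathcomp Require Import all_classical all_reals all_analysis.
Set Implicit Arguments. Unset Strict Implicit. Unset Printing Implicit Defensive.
Import Order.TTheory GRing.Theory Num.Theory.
Import numFieldNormedType.Exports.
Local Open Scope classical_set_scope.
Local Open Scope ring_scope.

Section Defs.
Variable R : realType.
Local Notation mu := (@lebesgue_measure R).

Definition L2 (f : R -> R) : Prop :=
  measurable_fun setT f /\ mu.-integrable setT (fun x => ((f x) ^+ 2)%:E).

Definition Lloc1 (g : R -> R) : Prop :=
  forall a b : R, mu.-integrable `[a, b] (fun x => (g x)%:E).

Definition W11loc_deriv (u g : R -> R) : Prop :=
  Lloc1 g /\ forall a b : R, a <= b -> u b - u a = Rintegral mu `[a, b] g.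

(* Graph of the real maximal quasi-differential operator S_max(q), written
   through Q (Q' = q):  (u, f) with u in Dom, f = l_Q[u] a.e.
   Elements of L_2 are handled through representatives; ut is the
   locally absolutely continuous representative of u, du = ut',
   v is the absolutely continuous representative of the quasi-derivative
   ut' - Q ut, dv = v'. *)
Definition SmaxR (Q : R -> R) (u f : R -> R) : Prop :=
  L2 u /\ L2 f /\
  exists ut du v dv : R -> R,
    {ae mu, forall x, u x = ut x} /\
    W11loc_deriv ut du /\
    W11loc_deriv v dv /\
    {ae mu, forall x, v x = du x - Q x * ut x} /\
    {ae mu, forall x, f x = - dv x - Q x * v x - (Q x) ^+ 2 * ut x}.

(* complex-valued functions R -> C, as (real part, imaginary part) *)
Definition cfun := ((R -> R) * (R -> R))%type.

Definition L2C (u : cfun) : Prop := L2 u.1 /\ L2 u.2.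

(* complex L_2(R) inner product <a, b> = int a * conj b, as (Re, Im) *)
Definition innerC (a b : cfun) : R * R :=
  (Rintegral mu setT (fun x => a.1 x * b.1 x + a.2 x * b.2 x),
   Rintegral mu setT (fun x => a.2 x * b.1 x - a.1 x * b.2 x)).

Definition adjointC (G : cfun -> cfun -> Prop) (v w : cfun) : Prop :=
  L2C v /\ L2C w /\ forall u f : cfun, G u f -> innerC f v = innerC u w.

Definition selfadjointC (G : cfun -> cfun -> Prop) : Prop :=
  forall v w : cfun, adjointC G v w <-> G v w.

(* S_max(q) acting in complex L_2(R) (real coefficients: componentwise) *)
Definition Smax (Q : R -> R) (u f : cfun) : Prop :=
  SmaxR Q u.1 f.1 /\ SmaxR Q u.2 f.2.

End Defs.

(* Main.v *)
(** Write a solution of l_Q[u] = f as a solution of the system u' = Qu + v,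
    v' = -Qv - Q^2 u - f with locally integrable coefficients.  The Lagrange
    identity (uz - vw)' = fw - ug reduces symmetry to the decay of u and v.
    Since Q is periodic, the integral of Q^2 over an interval of length d <= 1
    with an integer end point is at most K, the integral over a period; for d
    small, v is then almost constant on such an interval while u is small at
    two distant points of it, which bounds u and v there by the L_2 norms of u
    and f on the same interval: both tend to 0 along the integers.

    Conversely, let (v, w) belong to the adjoint.  Variation of constants gives
    a solution vt for the right-hand side w.  Every f in L_2 with compact
    support and orthogonal to the null solutions c and s is S_max(q)u for some u
    with compact support, so that v - vt is orthogonal to all such f; hence
    v - vt is a combination of c and s, and v solves the system for w. *)
Require Import Defs.
From HB Require Import structures.
From mathcomp Require Import all_boot all_order all_algebra.
From mathcomp Require Import all_classical all_reals all_analysis measurable_realfun.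
From mathcomp Require Import ring lra.
Set Implicit Arguments. Unset Strict Implicit. Unset Printing Implicit Defensive.
Import Order.TTheory GRing.Theory Num.Theory.
Import numFieldNormedType.Exports.
Local Open Scope classical_set_scope.
Local Open Scope ring_scope.

(** * Integrability on intervals *)

Section integrability.
Variable R : realType.
Local Notation mu := (@lebesgue_measure R).
Implicit Types (f g h u v : R -> R) (D : set R) (a b c x y : R).

Lemma ae_imply (P S : R -> Prop) : (forall x, P x -> S x) ->
  {ae mu, forall x, P x} -> {ae mu, forall x, S x}.
Proof. by move=> PS; exact: (@filterS _ _ (ae_filter_ringOfSetsType mu)). Qed.

Lemma integrable_le D f g : measurable D -> measurable_fun D f ->
  (forall x, D x -> `|f x| <= g x) -> mu.-integrable D (EFin \o g) ->
  mu.-integrable D (EFin \o f).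
Proof.
move=> mD mf fg ig; apply: (le_integrable _ _ _ ig) => //.
  exact/measurable_EFinP.
move=> x Dx /=; rewrite lee_fin (le_trans (fg _ Dx))// ler_norm//.
Qed.

Lemma integrable_fun_measurable D f :
  mu.-integrable D (EFin \o f) -> measurable_fun D f.
Proof. by move=> /integrableP[/measurable_EFinP]. Qed.

(** [|f g| <= f^2 + g^2], from the square of [|f| - |g|]. *)
Lemma integrable_mul_sqr D f g : measurable D ->
  measurable_fun D f -> measurable_fun D g ->
  mu.-integrable D (fun x => ((f x) ^+ 2)%:E) ->
  mu.-integrable D (fun x => ((g x) ^+ 2)%:E) ->
  mu.-integrable D (fun x => (f x * g x)%:E).
Proof.
move=> mD mf mg If Ig.
apply: (@integrable_le _ _ (fun x => f x ^+ 2 + g x ^+ 2)) => //.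
- exact: measurable_funM.
- move=> x _; rewrite normrM -(real_normK (num_real (f x))) -(real_normK (num_real (g x))).
  by have := sqr_ge0 (`|f x| - `|g x|); nra.
- exact: (integrableD _ If Ig).
Qed.

Lemma eq_Lloc1 f g : f =1 g -> Lloc1 f -> Lloc1 g.
Proof. by move=> /funext ->. Qed.

Lemma Lloc1_measurable f : Lloc1 f -> measurable_fun setT f.
Proof.
move=> If.
have -> : [set: R] = \bigcup_n `[- n%:R, n%:R]%classic.
  apply/seteqP; split => // x _.
  have [n xn] : exists n : nat, `|x| <= n%:R.
    by exists (Num.truncn `|x|).+1; rewrite ltW// truncnS_gt.
  by exists n => //=; rewrite in_itv/= -ler_norml.
apply/measurable_fun_bigcup => // n.
exact: integrable_fun_measurable (If _ _).
Qed.

Lemma Lloc1D f g : Lloc1 f -> Lloc1 g -> Lloc1 (fun x => f x + g x).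
Proof. by move=> If Ig a b; have := integrableD _ (If a b) (Ig a b); apply. Qed.

Lemma Lloc1Z c f : Lloc1 f -> Lloc1 (fun x => c * f x).
Proof.
move=> If a b; have := integrableZl _ c (If a b).
by apply.
Qed.

Lemma Lloc1N f : Lloc1 f -> Lloc1 (fun x => - f x).
Proof. by move/(Lloc1Z (-1)); apply: eq_Lloc1 => x; rewrite mulN1r. Qed.

Lemma Lloc1B f g : Lloc1 f -> Lloc1 g -> Lloc1 (fun x => f x - g x).
Proof. by move=> If Ig; apply: Lloc1D => //; exact: Lloc1N. Qed.

Lemma Lloc1_norm f : Lloc1 f -> Lloc1 (fun x => `|f x|).
Proof.
move=> If a b; apply: (@integrable_le _ _ (fun x => `|f x|)) => //.
- by apply: measurableT_comp => //; apply: measurable_funTS; exact: Lloc1_measurable.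
- by move=> x _; rewrite normr_id.
- by have /integrable_abse := If a b.
Qed.

Lemma Lloc1_cst c : Lloc1 (fun=> c).
Proof.
move=> a b; apply: continuous_compact_integrable => //; first exact: segment_compact.
by move=> x; exact: cvg_cst.
Qed.

Lemma segment_bounded h a b : continuous h ->
  exists2 M, 0 <= M & forall x, a <= x <= b -> `|h x| <= M.
Proof.
move=> ch; have /compact_bounded [M [Mr hM]] : compact (h @` `[a, b]).
  by apply: continuous_compact; [exact: continuous_subspaceT|exact: segment_compact].
exists (`|M| + 1) => [|x xab]; first by rewrite addr_ge0.
by apply: hM; [rewrite (le_lt_trans (ler_norm _))// ltrDl|exists x => //=; rewrite in_itv].
Qed.

Lemma Lloc1_contM h f : continuous h -> Lloc1 f -> Lloc1 (fun x => h x * f x).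
Proof.
move=> ch If a b.
have [M M0 hM] := segment_bounded a b ch.
apply: (@integrable_le _ _ (fun x => M * `|f x|)) => //.
- apply: measurable_funM; apply: measurable_funTS.
    exact: continuous_measurable_fun.
  exact: Lloc1_measurable.
- move=> x; rewrite /= in_itv/= => xab; rewrite normrM ler_pM//.
  exact: hM.
- exact: (Lloc1Z M (Lloc1_norm If)).
Qed.

Lemma Lloc1_cont h : continuous h -> Lloc1 h.
Proof.
move=> ch; apply: (@eq_Lloc1 (fun x => h x * 1)) => [x|]; first by rewrite mulr1.
by apply: Lloc1_contM => //; exact: Lloc1_cst.
Qed.

Lemma Lloc1_mul_sqr f g : measurable_fun setT f -> measurable_fun setT g ->
  Lloc1 (fun x => f x ^+ 2) -> Lloc1 (fun x => g x ^+ 2) ->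
  Lloc1 (fun x => f x * g x).
Proof.
by move=> mf mg If Ig a b; apply: integrable_mul_sqr => //; exact: measurable_funTS.
Qed.

Lemma Lloc1_sqr f : measurable_fun setT f ->
  Lloc1 (fun x => f x ^+ 2) -> Lloc1 f.
Proof.
move=> mf If; apply: (@eq_Lloc1 (fun x => f x * 1)) => [x|]; first by rewrite mulr1.
apply: Lloc1_mul_sqr => //.
by apply: (@eq_Lloc1 (fun=> 1)) => [x|]; [rewrite expr1n|exact: Lloc1_cst].
Qed.

Lemma integral_chasles f a b c : Lloc1 f -> a <= b -> b <= c ->
  Rintegral mu `[a, c] f = Rintegral mu `[a, b] f + Rintegral mu `[b, c] f.
Proof.
move=> If ab bc; have := @Rintegral_itvB R f (BLeft a) (BRight c) b (If _ _).
rewrite !bnd_simp => /(_ ab bc) /eqP; rewrite subr_eq addrC => /eqP ->; congr (_ + _).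
apply: Rintegral_itv_obnd_cbnd.
by apply: integrableS (If b c) => //; apply: subset_itvr; rewrite bnd_simp.
Qed.

Lemma itv_le_integral f g a b : Lloc1 f -> Lloc1 g ->
  (forall x, a <= x <= b -> f x <= g x) ->
  Rintegral mu `[a, b] f <= Rintegral mu `[a, b] g.
Proof.
move=> If Ig fg; apply: le_Rintegral; [by []|exact: If|exact: Ig|].
by move=> x; rewrite /= in_itv/=; exact: fg.
Qed.

Lemma itv_le_norm_integral f g a b : Lloc1 f -> Lloc1 g ->
  (forall x, a <= x <= b -> `|f x| <= g x) ->
  `|Rintegral mu `[a, b] f| <= Rintegral mu `[a, b] g.
Proof.
move=> If Ig fg; apply: (le_trans (le_normr_Rintegral _ (If a b))) => //.
by apply: itv_le_integral => //; exact: Lloc1_norm.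
Qed.

Lemma itv_integral_ge0 f a b : (forall x, 0 <= f x) -> 0 <= Rintegral mu `[a, b] f.
Proof. by move=> f0; exact: Rintegral_ge0. Qed.

Lemma sub_itv_le_integral f a b a' b' : Lloc1 f -> (forall x, 0 <= f x) ->
  a' <= a -> b <= b' -> Rintegral mu `[a, b] f <= Rintegral mu `[a', b'] f.
Proof.
move=> If f0 aa bb.
have [ab|ba] := leP a b; last first.
  by rewrite set_itv_ge ?bnd_simp -?ltNge// Rintegral_set0 itv_integral_ge0.
rewrite (@integral_chasles f a' a b')// ?(le_trans ab)// (@integral_chasles f a b b')//.
by rewrite addrCA lerDl addr_ge0// itv_integral_ge0.
Qed.

Lemma itv_integral_cst c a b : a <= b -> Rintegral mu `[a, b] (fun=> c) = c * (b - a).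
Proof.
move=> ab; rewrite Rintegral_cst//= lebesgue_measure_itv/= lte_fin.
by case: ltP => [//|ba]; rewrite (_ : b = a) ?subrr//; apply/eqP; rewrite eq_le ab ba.
Qed.

Lemma itv_integralD f g a b : Lloc1 f -> Lloc1 g ->
  Rintegral mu `[a, b] (fun x => f x + g x) = Rintegral mu `[a, b] f + Rintegral mu `[a, b] g.
Proof. by move=> If Ig; rewrite (RintegralD _ (If a b) (Ig a b)). Qed.

Lemma itv_integralZ c f a b : Lloc1 f ->
  Rintegral mu `[a, b] (fun x => c * f x) = c * Rintegral mu `[a, b] f.
Proof. by move=> If; rewrite (RintegralZl _ _ (If a b)). Qed.

Lemma itv_integralN f a b : Lloc1 f ->
  Rintegral mu `[a, b] (fun x => - f x) = - Rintegral mu `[a, b] f.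
Proof.
by move=> If; rewrite -mulN1r -itv_integralZ//; apply: eq_Rintegral => x _; rewrite mulN1r.
Qed.

Lemma eq_itv_integral f g a b : (forall x, a <= x <= b -> f x = g x) ->
  Rintegral mu `[a, b] f = Rintegral mu `[a, b] g.
Proof. by move=> fg; apply: eq_Rintegral => x; rewrite inE/= in_itv/=; exact: fg. Qed.

Lemma ae_eq_integrable D f g : measurable D ->
  measurable_fun D f -> measurable_fun D g ->
  {ae mu, forall x, f x = g x} ->
  mu.-integrable D (EFin \o f) -> mu.-integrable D (EFin \o g).
Proof.
move=> mD mf mg fg /integrableP[_ foo]; apply/integrableP; split.
  exact/measurable_EFinP.
rewrite (le_lt_trans _ foo)// le_eqVlt; apply/orP; left; apply/eqP.
apply: ae_eq_integral => //.
- by apply: measurableT_comp => //; exact/measurable_EFinP.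
- by apply: measurableT_comp => //; exact/measurable_EFinP.
- by apply: ae_imply fg => x /= -> _.
Qed.

Lemma ae_eq_Lloc1 f g : measurable_fun setT g -> {ae mu, forall x, f x = g x} ->
  Lloc1 f -> Lloc1 g.
Proof.
move=> mg fg If a b; apply: (ae_eq_integrable _ _ _ fg (If a b)) => //.
- by apply: measurable_funTS; exact: Lloc1_measurable.
- exact: measurable_funTS.
Qed.

Lemma ae_eq_Rintegral D f g : measurable D -> measurable_fun setT f -> measurable_fun setT g ->
  {ae mu, forall x, f x = g x} -> Rintegral mu D f = Rintegral mu D g.
Proof.
move=> mD mf mg fg; congr fine; apply: ae_eq_integral => //.
- by apply/measurable_EFinP; exact: measurable_funTS.
- by apply/measurable_EFinP; exact: measurable_funTS.
- by apply: ae_imply fg => x fgx _; rewrite fgx.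
Qed.

End integrability.

(** * Locally absolutely continuous functions *)

Section W11_calculus.
Variable R : realType.
Local Notation mu := (@lebesgue_measure R).
Implicit Types (f g h u v du dv E T : R -> R) (a b c x y : R).

(** Integral from [a] to [x], with the sign made explicit: for [x < a] the interval [[a, x]] is
    empty and would contribute 0. *)
Definition prim a f x : R :=
  if a <= x then Rintegral mu `[a, x] f else - Rintegral mu `[x, a] f.

Lemma primB a f x y : Lloc1 f -> x <= y ->
  prim a f y - prim a f x = Rintegral mu `[x, y] f.
Proof.
move=> If xy; rewrite /prim.
have [ax|xa] := leP a x.
  by rewrite (le_trans ax xy) (integral_chasles If ax xy) addrC addKr.
have [ay|ya] := leP a y.
  by rewrite opprK (integral_chasles If (ltW xa) ay) addrC.
by rewrite (integral_chasles If xy (ltW ya)) opprK addrC addrK.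
Qed.

Lemma prim_base a f : prim a f a = 0.
Proof. by rewrite /prim lexx set_itv1 Rintegral_set1. Qed.

Lemma eq_prim a f g x : f =1 g -> prim a f x = prim a g x.
Proof. by move=> /funext ->. Qed.

Lemma primD a f g x : Lloc1 f -> Lloc1 g ->
  prim a (fun t => f t + g t) x = prim a f x + prim a g x.
Proof.
by move=> If Ig; rewrite /prim; case: ifPn => _; rewrite itv_integralD// opprD.
Qed.

Lemma primZ a c f x : Lloc1 f -> prim a (fun t => c * f t) x = c * prim a f x.
Proof.
by move=> If; rewrite /prim; case: ifPn => _; rewrite itv_integralZ// mulrN.
Qed.

(** To the left of [a] the primitive of a nonnegative function is nonpositive, hence the absolute
    value on the right. *)
Lemma prim_le_norm a f g x : Lloc1 f -> Lloc1 g ->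
  (forall t, (a <= t <= x) || (x <= t <= a) -> `|f t| <= g t) ->
  `|prim a f x| <= `|prim a g x|.
Proof.
move=> If Ig fg; rewrite /prim; case: ifPn => _; rewrite ?normrN;
  apply: le_trans (ler_norm _); apply: itv_le_norm_integral => // t txa;
  by apply: fg; rewrite txa ?orbT.
Qed.

Lemma W11_increment u g a b : W11loc_deriv u g -> a <= b ->
  u b - u a = Rintegral mu `[a, b] g.
Proof. by case=> _; apply. Qed.

Lemma W11_prim c a f : Lloc1 f -> W11loc_deriv (fun x => c + prim a f x) f.
Proof. by move=> If; split=> // x y xy; rewrite -(primB a If xy); ring. Qed.

Lemma eq_W11 u v f g : u =1 v -> f =1 g -> W11loc_deriv u f -> W11loc_deriv v g.
Proof. by move=> /funext -> /funext ->. Qed.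

Lemma W11D u v f g : W11loc_deriv u f -> W11loc_deriv v g ->
  W11loc_deriv (fun x => u x + v x) (fun x => f x + g x).
Proof.
move=> [If uf] [Ig vg]; split; first exact: Lloc1D.
by move=> a b ab; rewrite itv_integralD// -uf// -vg// opprD addrACA.
Qed.

Lemma W11Z c u f : W11loc_deriv u f -> W11loc_deriv (fun x => c * u x) (fun x => c * f x).
Proof.
move=> [If uf]; split; first exact: Lloc1Z.
by move=> a b ab; rewrite itv_integralZ// -uf// mulrBr.
Qed.

Lemma W11B u v f g : W11loc_deriv u f -> W11loc_deriv v g ->
  W11loc_deriv (fun x => u x - v x) (fun x => f x - g x).
Proof.
move=> uf /(W11Z (-1)) vg; apply: eq_W11 (W11D uf vg) => x; by rewrite mulN1r.
Qed.

Lemma W11_cst c : W11loc_deriv (fun=> c) (fun=> 0 : R).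
Proof.
split; first exact: Lloc1_cst.
by move=> a b ab; rewrite itv_integral_cst// mul0r subrr.
Qed.

Lemma W11_eq u v g x0 : W11loc_deriv u g -> W11loc_deriv v g -> u x0 = v x0 -> u =1 v.
Proof.
move=> ug vg uv0 x.
have [xx0|/ltW x0x] := leP x x0.
  by have := W11_increment ug xx0; rewrite -(W11_increment vg xx0) uv0 => /addrI/oppr_inj.
by have := W11_increment ug x0x; rewrite -(W11_increment vg x0x) uv0 => /addIr.
Qed.

(** A derivative enters only through its integrals, so null sets do not matter. This turns the
    almost everywhere relations of [SmaxR] into pointwise formulas. *)
Lemma ae_eq_W11 u f g : measurable_fun setT g -> {ae mu, forall x, f x = g x} ->
  W11loc_deriv u f -> W11loc_deriv u g.
Proof.
move=> mg fg [If uf]; split; first exact: ae_eq_Lloc1 If.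
move=> a b ab; rewrite uf//; apply: ae_eq_Rintegral => //.
exact: Lloc1_measurable.
Qed.

Lemma W11_cont u g : W11loc_deriv u g -> continuous u.
Proof.
move=> [Ig ug] x.
(* Continuity is local: on [[x - 1, x + 1]], [u] is [u (x - 1)] plus the integral from [x - 1], and
   [x] is interior. *)
have x1 : x - 1 < x + 1 by lra.
have := parameterized_integral_continuous (ltW x1) (Ig (x - 1) (x + 1)).
move=> /within_continuous_continuous => /(_ x).
have xin : x \in `](x - 1), (x + 1)[ by rewrite in_itv/=; apply/andP; split; lra.
move=> /(_ x1 xin) c0.
have c1 : parameterized_integral mu (x - 1) y g + u (x - 1) @[y --> x] --> u x.
  rewrite [X in _ --> X](_ : u x = parameterized_integral mu (x - 1) x g + u (x - 1)).
    by apply: cvgD => //; exact: cvg_cst.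
  by rewrite /parameterized_integral -ug ?subrK//; lra.
apply: cvg_trans c1; apply: near_eq_cvg.
near=> y; rewrite /parameterized_integral -ug ?subrK//; near: y.
exists 1 => //= y; rewrite /ball_ /= ltr_norml => /andP[]; lra.
Unshelve. all: by end_near. Qed.

(* Halving the increment of T by the intermediate value theorem gains a factor 2
   each time. *)
Lemma eq_of_sqr_increment E T :
  continuous T -> {homo T : x y / x <= y} ->
  (forall x y, x <= y -> `|E y - E x| <= (T y - T x) ^+ 2) -> forall x y, E x = E y.
Proof.
move=> cT mT ET.
have H n : forall x y, x <= y -> `|E y - E x| <= (T y - T x) ^+ 2 / 2 ^+ n.
  elim: n => [x y xy|n IHn x y xy]; first by rewrite expr0 divr1 ET.
  have Txy := mT _ _ xy.
  have [c] : exists2 c, c \in `[x, y] & T c = (T x + T y) / 2.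
    apply: IVT => //; first exact: continuous_subspaceT.
    by rewrite min_l// max_r//; apply/andP; split; lra.
  rewrite in_itv/= => /andP[xc cy] Tc.
  rewrite (_ : E y - E x = (E y - E c) + (E c - E x)); last by ring.
  apply: (le_trans (ler_normD _ _)).
  apply: (le_trans (lerD (IHn _ _ cy) (IHn _ _ xc))).
  rewrite Tc (exprS 2 n) invfM.
  have := sqr_ge0 (T y - T x); have : 0 < (2 ^+ n : R)^-1 by rewrite invr_gt0 exprn_gt0.
  set w := (2 ^+ n)^-1 => w0 T0.
  suff -> : (T y - (T x + T y) / 2) ^+ 2 * w + ((T x + T y) / 2 - T x) ^+ 2 * w = 
     (T y - T x) ^+ 2 * (2^-1 * w) by [].
  by field.
have wlg x y : x <= y -> E x = E y.
  move=> xy; apply/eqP; rewrite eq_sym -subr_eq0 -normr_eq0 eq_le normr_ge0 andbT.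
  have hc : (T y - T x) ^+ 2 / 2 ^+ n @[n --> \oo] --> (0 : R).
    rewrite -(mulr0 ((T y - T x) ^+ 2)); apply: cvgM; first exact: cvg_cst.
    under eq_fun do rewrite -exprVn.
    by apply: cvg_expr; rewrite ger0_norm ?invr_ge0// invf_lt1 ?ltr1n.
  rewrite -(cvg_lim _ hc)//; apply: limr_ge; first by apply/cvg_ex; exists 0.
  by apply: nearW => n; exact: H.
by move=> x y; case: (leP x y) => [|/ltW] /wlg.
Qed.

(* The defect E of the product rule satisfies |E y - E x| <= (T y - T x)^2 with
   T a primitive of |du| + |dv|. *)
Lemma W11M u v du dv : W11loc_deriv u du -> W11loc_deriv v dv ->
  W11loc_deriv (fun x => u x * v x) (fun x => du x * v x + u x * dv x).
Proof.
move=> uW vW.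
have cu := W11_cont uW; have cv := W11_cont vW.
have Idu := uW.1; have Idv := vW.1.
pose g x := du x * v x + u x * dv x.
have I1 : Lloc1 (fun x => du x * v x).
  by apply: (@eq_Lloc1 _ (fun x => v x * du x)) => [x|]; [rewrite mulrC|exact: Lloc1_contM].
have Ig : Lloc1 g by apply: Lloc1D => //; exact: Lloc1_contM.
pose m x := `|du x| + `|dv x|.
have Im : Lloc1 m by apply: Lloc1D; exact: Lloc1_norm.
pose T := prim 0 m.
pose E x := u x * v x - prim 0 g x.
have TB x y : x <= y -> T y - T x = Rintegral mu `[x, y] m by exact: primB.
have EE : forall x y, E x = E y.
  apply: (@eq_of_sqr_increment E T).
  - have -> : T = (fun x => 0 + prim 0 m x) by apply/funext => x; rewrite add0r.
    exact: W11_cont (W11_prim 0 0 Im).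
  - move=> x y xy; rewrite -subr_ge0 TB//.
    by apply: itv_integral_ge0 => z; rewrite addr_ge0.
  - move=> x y xy; rewrite TB//; set D := Rintegral _ _ _.
    have D0 : 0 <= D by apply: itv_integral_ge0 => z; rewrite addr_ge0.
    (* Freezing [v] at [y] and [u] at [x] is exact, as [u y v y - u x v x] is [v y] times the
       increment of [u] plus [u x] times the increment of [v]. What remains are the differences
       [v y - v t] and [u x - u t], each at most [D]. *)
    have -> : E y - E x = Rintegral mu `[x, y]
        (fun t => (v y * du t + u x * dv t) + (-1) * g t).
      rewrite itv_integralD//; last 2 first.
        by apply: Lloc1D; exact: Lloc1Z.
        exact: Lloc1Z.
      rewrite itv_integralD; [|exact: Lloc1Z|exact: Lloc1Z].
      rewrite !itv_integralZ// -(W11_increment uW xy) -(W11_increment vW xy).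
      by rewrite -(primB 0 Ig xy) /E; ring.
    rewrite expr2 -itv_integralZ//; apply: itv_le_norm_integral.
    - by apply: Lloc1D; [apply: Lloc1D|]; exact: Lloc1Z.
    - exact: Lloc1Z.
    - move=> t /andP[xt ty].
      have -> : v y * du t + u x * dv t + -1 * g t =
        (v y - v t) * du t + (u x - u t) * dv t by rewrite /g; ring.
      apply: (le_trans (ler_normD _ _)); rewrite !normrM mulrDr.
      rewrite lerD// ler_wpM2r//.
        rewrite (W11_increment vW ty).
        apply: (@le_trans _ _ (Rintegral mu `[t, y] m)).
          by apply: itv_le_norm_integral => // z _; rewrite lerDr.
        by apply: sub_itv_le_integral => // z; rewrite addr_ge0.
      rewrite distrC (W11_increment uW xt).
      apply: (@le_trans _ _ (Rintegral mu `[x, t] m)).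
        by apply: itv_le_norm_integral => // z _; rewrite lerDl.
      by apply: sub_itv_le_integral => // z; rewrite addr_ge0.
split=> // a b ab; have := EE a b; rewrite /E -(primB 0 Ig ab); lra.
Qed.

End W11_calculus.

(** * Linear systems with locally integrable coefficients *)

Section dominated.
Variable R : realType.
Local Notation mu := (@lebesgue_measure R).
Implicit Types (D : set R) (F : nat -> R -> R) (f g : R -> R) (a b c x : R).

Lemma Rintegral_dominated_cvg D F f g : measurable D ->
  (forall n, measurable_fun D (F n)) ->
  (forall x, D x -> F n x @[n --> \oo] --> f x) ->
  mu.-integrable D (EFin \o g) ->
  (forall n x, D x -> `|F n x| <= g x) ->
  mu.-integrable D (EFin \o f) /\
  Rintegral mu D (F n) @[n --> \oo] --> Rintegral mu D f.
Proof.
move=> mD mF Ff ig Fg.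
have mf : measurable_fun D f by exact: measurable_fun_cvg Ff.
have [] := @dominated_convergence _ _ _ mu D _ (fun n => EFin \o F n) (EFin \o f) (EFin \o g).
- exact: mD.
- move=> n /=; apply/measurable_EFinP; exact: mF.
- apply/measurable_EFinP; exact: mf.
- by apply: aeW => x Dx; apply: cvg_EFin; [exact: nearW|exact: Ff].
- exact: ig.
- by apply: aeW => x n Dx /=; rewrite lee_fin Fg.
move=> If _ cF; split => //.
have fE : (\int[mu]_(x in D) (EFin \o f) x)%E = (Rintegral mu D f)%:E.
  by rewrite /Rintegral fineK//; apply: integrable_fin_num => //; exact: mD.
rewrite fE in cF; exact: (fine_cvg cF).
Qed.

Lemma prim_dominated_cvg a F f g : (forall n, Lloc1 (F n)) ->
  (forall x, F n x @[n --> \oo] --> f x) -> Lloc1 g ->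
  (forall n x, `|F n x| <= g x) ->
  Lloc1 f /\ forall x, prim a (F n) x @[n --> \oo] --> prim a f x.
Proof.
move=> IF Ff Ig Fg.
have H x y := @Rintegral_dominated_cvg `[x, y]%classic F f g (measurable_itv _)
  (fun n => measurable_funTS (Lloc1_measurable (IF n))) (fun t _ => Ff t) (Ig x y)
  (fun n t _ => Fg n t).
split=> [x y|x]; first by have [] := H x y.
rewrite /prim; case: ifPn => _; first by have [] := H a x.
by apply: cvgN; have [] := H x a.
Qed.

End dominated.

(** * Picard iteration for linear systems of two equations *)

Section linear_system.
Variable R : realType.
Local Notation mu := (@lebesgue_measure R).
Implicit Types (f g h u v du dv m : R -> R) (a b c x y : R).

Lemma W11_expr u du n : W11loc_deriv u du ->
  W11loc_deriv (fun x => u x ^+ n.+1) (fun x => n.+1%:R * (du x * u x ^+ n)).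
Proof.
move=> uW; elim: n => [|n IHn].
  by apply: eq_W11 uW => x; rewrite ?expr1// expr0 mulr1 mul1r.
apply: eq_W11 (W11M IHn uW) => x; first by rewrite -exprSr.
by rewrite -[in RHS]natr1 !exprS; ring.
Qed.

Lemma prim_cont a f : Lloc1 f -> continuous (prim a f).
Proof.
move=> If; have -> : prim a f = (fun x => 0 + prim a f x) by apply/funext => x; rewrite add0r.
exact: W11_cont (W11_prim 0 a If).
Qed.

(* The absolute values account for x < 0, where prim 0 m is negative. *)
Lemma prim_norm_expr m n x : Lloc1 m -> (forall t, 0 <= m t) ->
  `|prim 0 (fun t => m t * `|prim 0 m t| ^+ n) x| = `|prim 0 m x| ^+ n.+1 / n.+1%:R.
Proof.
move=> Im m0; set M := prim 0 m.
have cM : continuous M by exact: prim_cont.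
have W : W11loc_deriv M m.
  by apply: eq_W11 (W11_prim 0 0 Im) => y //; rewrite add0r.
have Iexp : Lloc1 (fun t => m t * M t ^+ n).
  apply: (@eq_Lloc1 _ (fun t => M t ^+ n * m t)) => [y|]; first by rewrite mulrC.
  apply: Lloc1_contM => // y.
  by apply: (@continuous_comp _ _ _ M (fun z => z ^+ n)); [exact: cM|exact: exprn_continuous].
have n0 : n.+1%:R != 0 :> R by rewrite pnatr_eq0.
have MB y z : y <= z -> Rintegral mu `[y, z] (fun t => m t * M t ^+ n) =
    (M z ^+ n.+1 - M y ^+ n.+1) / n.+1%:R.
  move=> yz; have := W11_increment (W11_expr n W) yz; rewrite itv_integralZ// => ->.
  by rewrite mulrC mulKf.
have M0 : M 0 = 0 by exact: prim_base.
have Mpos y : 0 <= y -> 0 <= M y.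
  by move=> y0; rewrite /M /prim y0; apply: itv_integral_ge0.
have Mneg y : y <= 0 -> M y <= 0.
  rewrite le_eqVlt => /predU1P[->|y0]; first by rewrite M0.
  by rewrite /M /prim [0 <= y]leNgt y0/= oppr_le0; exact: itv_integral_ge0.
rewrite {1}/prim; case: ifPn => [x0|]; last rewrite -ltNge => /ltW x0.
  rewrite (@eq_itv_integral _ _ (fun t => m t * M t ^+ n)); last first.
    by move=> t /andP[t0 _]; rewrite (ger0_norm (Mpos _ t0)).
  by rewrite MB// M0 expr0n subr0 normrM normfV normrX !(ger0_norm (ler0n _ _)).
(* For [x <= 0] the primitive [M] is nonpositive, so the sign [(-1)^n] comes out and disappears
   under the outer absolute value. *)
rewrite (@eq_itv_integral _ _ (fun t => (- 1) ^+ n * (m t * M t ^+ n))); last first.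
  move=> t /andP[_ t0]; rewrite (ler0_norm (Mneg _ t0)).
  by rewrite [(- M t) ^+ n]exprNn mulrCA.
rewrite itv_integralZ// MB// M0 expr0n sub0r normrN !normrM normrX normrN1 expr1n mul1r.
by rewrite normrN normfV normrX !(ger0_norm (ler0n _ _)).
Qed.

Section picard.
Variables (a11 a12 a21 a22 : R -> R) (al be : R).
Hypotheses (I11 : Lloc1 a11) (I12 : Lloc1 a12) (I21 : Lloc1 a21) (I22 : Lloc1 a22).

(** Not the n-th iterate but the difference of two consecutive ones: the n-th term of the Neumann
    series, whose sum is the solution. *)
Fixpoint picard n : (R -> R) * (R -> R) :=
  if n is k.+1 then let d := picard k in
    (prim 0 (fun t => d.1 t * a11 t + d.2 t * a12 t),
     prim 0 (fun t => d.1 t * a21 t + d.2 t * a22 t))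
  else (fun=> al, fun=> be).

Let m t := `|a11 t| + `|a12 t| + (`|a21 t| + `|a22 t|).
Let M := prim 0 m.
Let C := `|al| + `|be|.

Let Im : Lloc1 m.
Proof. by apply: Lloc1D; apply: Lloc1D; exact: Lloc1_norm. Qed.

Let Icomb u v f g : continuous u -> continuous v -> Lloc1 f -> Lloc1 g ->
  Lloc1 (fun t => u t * f t + v t * g t).
Proof. by move=> cu cv If Ig; apply: Lloc1D; exact: Lloc1_contM. Qed.

Let picard_cont n : continuous (picard n).1 /\ continuous (picard n).2.
Proof.
elim: n => [|n [c1 c2]] /=; first by split=> x; exact: cvg_cst.
by split; apply: prim_cont; exact: Icomb.
Qed.

(** Induction: integrating [m] times [C |M|^n / n!] gives [C |M|^(n+1) / (n+1)!], where [m] is the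
    sum of the absolute values of the four coefficients and [M] its primitive. *)
Let picard_bound n x : `|(picard n).1 x| <= C * exp_coeff `|M x| n /\
  `|(picard n).2 x| <= C * exp_coeff `|M x| n.
Proof.
have m0 t : 0 <= m t by rewrite !addr_ge0.
elim: n x => [|n IHn] x /=.
  by rewrite /exp_coeff/= expr0 fact0 divr1 mulr1 /C; split; [rewrite lerDl|rewrite lerDr].
have [c1 c2] := picard_cont n.
pose k := C / n`!%:R.
have k0 : 0 <= k by rewrite divr_ge0// addr_ge0.
have cM : continuous M by exact: prim_cont.
have Ig : Lloc1 (fun t => m t * `|M t| ^+ n).
  apply: (@eq_Lloc1 _ (fun t => `|M t| ^+ n * m t)) => [y|]; first by rewrite mulrC.
  apply: Lloc1_contM => // y.
  apply: (@continuous_comp _ _ _ (fun y => `|M y|) (fun z => z ^+ n)).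
    by apply: continuous_comp; [exact: cM|exact: norm_continuous].
  exact: exprn_continuous.
have -> : C * exp_coeff `|M x| n.+1 = `|prim 0 (fun t => k * (m t * `|M t| ^+ n)) x|.
  rewrite primZ// normrM prim_norm_expr// (ger0_norm k0) /k /exp_coeff/= factS natrM invfM -/M.
  by ring.
have key f g t : (`|f t| + `|g t| <= m t) ->
    `|(picard n).1 t * f t + (picard n).2 t * g t| <= k * (m t * `|M t| ^+ n).
  move=> fgm; have [b1 b2] := IHn t.
  apply: (le_trans (ler_normD _ _)); rewrite !normrM.
  apply: (@le_trans _ _ (C * exp_coeff `|M t| n * (`|f t| + `|g t|))).
    by rewrite mulrDr lerD// ler_wpM2r.
  apply: (@le_trans _ _ (C * exp_coeff `|M t| n * m t)).
    by rewrite ler_wpM2l//; apply: le_trans b1.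
  by rewrite le_eqVlt /k /exp_coeff /=; apply/orP; left; apply/eqP; ring.
split; apply: prim_le_norm; try exact: Icomb; try exact: Lloc1Z; move=> t _; apply: key.
  by rewrite lerDl addr_ge0.
by rewrite lerDr addr_ge0.
Qed.

(** Comparison with the exponential series. The bound on the partial sums is uniform in [n], so it
    can dominate them under the integral. *)
Let cvg_of_exp_bound (d : nat -> R) x : (forall n, `|d n| <= C * exp_coeff `|M x| n) ->
  series d n @[n --> \oo] --> limn (series d) /\
  forall n, `|series d n| <= C * expR `|M x|.
Proof.
move=> dB.
have C0 : 0 <= C by rewrite addr_ge0.
have e0 n : 0 <= exp_coeff `|M x| n by rewrite /exp_coeff/= divr_ge0// exprn_ge0.
have cE : cvgn (series (exp_coeff `|M x|)) by exact: is_cvg_series_exp_coeff.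
split.
  apply: normed_cvg; apply: (@series_le_cvg _ _ (fun n => C * exp_coeff `|M x| n)).
  - by move=> n; exact: normr_ge0.
  - by move=> n; exact: mulr_ge0.
  - exact: dB.
  - exact: is_cvg_seriesZ.
move=> n; rewrite /series/=; apply: (le_trans (ler_norm_sum _ _ _)).
apply: (le_trans (ler_sum _ (fun i _ => dB i))).
rewrite -mulr_sumr ler_wpM2l// /expR.
by apply: (nondecreasing_cvgn_le _ cE); exact: nondecreasing_series.
Qed.

(** The partial sums satisfy the integral equation with the index shifted by one; dominated
    convergence carries it to the limit. *)
Lemma linear_system_solution : exists u v, [/\ u 0 = al, v 0 = be,
  W11loc_deriv u (fun x => u x * a11 x + v x * a12 x) &
  W11loc_deriv v (fun x => u x * a21 x + v x * a22 x)].
Proof.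
pose s1 n x := series (fun k => (picard k).1 x) n.
pose s2 n x := series (fun k => (picard k).2 x) n.
pose u x := limn (s1 ^~ x); pose v x := limn (s2 ^~ x).
have B1 x := @cvg_of_exp_bound (fun k => (picard k).1 x) x (fun n => (picard_bound n x).1).
have B2 x := @cvg_of_exp_bound (fun k => (picard k).2 x) x (fun n => (picard_bound n x).2).
have cs n : continuous (s1 n) /\ continuous (s2 n).
  elim: n => [|n [c1 c2]].
    split.
      have -> : s1 0 = fun=> 0 by apply/funext => x; rewrite /s1 /series/= big_geq.
      by move=> x; exact: cvg_cst.
    have -> : s2 0 = fun=> 0 by apply/funext => x; rewrite /s2 /series/= big_geq.
    by move=> x; exact: cvg_cst.
  have [d1 d2] := picard_cont n.
  split.
    have -> : s1 n.+1 = fun x => s1 n x + (picard n).1 x.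
      by apply/funext => x; rewrite /s1 /series/= big_nat_recr.
    by move=> x; apply: cvgD; [exact: c1|exact: d1].
  have -> : s2 n.+1 = fun x => s2 n x + (picard n).2 x.
    by apply/funext => x; rewrite /s2 /series/= big_nat_recr.
  by move=> x; apply: cvgD; [exact: c2|exact: d2].
have rec n x :
    s1 n.+1 x = al + prim 0 (fun t => s1 n t * a11 t + s2 n t * a12 t) x /\
    s2 n.+1 x = be + prim 0 (fun t => s1 n t * a21 t + s2 n t * a22 t) x.
  (* At index 0 the sums are empty, the integrals vanish, and the next partial sum is the constant
     pair [(al, be)]. *)
  elim: n => [|n [IH1 IH2]].
    rewrite /s1 /s2 /series/= !big_nat1/=.
    have e f g : prim 0 (fun t => (\sum_(0 <= k < 0) (picard k).1 t) * f t +
        (\sum_(0 <= k < 0) (picard k).2 t) * g t) x = 0.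
      rewrite (@eq_prim _ _ _ (fun=> 0 * 0)) ?primZ ?mul0r//; first exact: Lloc1_cst.
      by move=> t; rewrite !big_geq// !mul0r addr0.
    by rewrite !e !addr0.
  have [c1 c2] := cs n; have [d1 d2] := picard_cont n.
  have e1 y : s1 n.+1 y = s1 n y + (picard n).1 y by rewrite /s1 /series/= big_nat_recr.
  have e2 y : s2 n.+1 y = s2 n y + (picard n).2 y by rewrite /s2 /series/= big_nat_recr.
  have e f g : Lloc1 f -> Lloc1 g ->
     prim 0 (fun t => s1 n.+1 t * f t + s2 n.+1 t * g t) x =
     prim 0 (fun t => s1 n t * f t + s2 n t * g t) x +
     prim 0 (fun t => (picard n).1 t * f t + (picard n).2 t * g t) x.
    move=> If Ig; rewrite -primD; [|exact: Icomb|exact: Icomb].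
    by apply: eq_prim => t; rewrite e1 e2; ring.
  rewrite !e// !addrA -IH1 -IH2.
  by split; rewrite [LHS]/series [LHS]big_nat_recr.
have C0 : 0 <= C by rewrite addr_ge0.
(* [G] bounds all partial sums and is continuous, so its product with a locally integrable
   coefficient is a locally integrable dominating function. *)
pose G x := C * expR `|M x|.
have cG : continuous G.
  move=> x; apply: cvgM; first exact: cvg_cst.
  apply: (@continuous_comp _ _ _ (fun y => `|M y|) expR); last exact: continuous_expR.
  apply: continuous_comp; last exact: norm_continuous.
  exact: (prim_cont Im).
have lim f g : Lloc1 f -> Lloc1 g ->
    Lloc1 (fun t => u t * f t + v t * g t) /\
    forall x, prim 0 (fun t => s1 n t * f t + s2 n t * g t) x @[n --> \oo] -->
      prim 0 (fun t => u t * f t + v t * g t) x.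
  move=> If Ig.
  apply: (@prim_dominated_cvg _ _ _ _ (fun t => G t * (`|f t| + `|g t|))).
  - by move=> n; have [c1 c2] := cs n; exact: Icomb.
  - move=> x; apply: cvgD; apply: cvgMl.
      exact: (B1 x).1.
    exact: (B2 x).1.
  - by apply: Lloc1_contM => //; apply: Lloc1D; exact: Lloc1_norm.
  - move=> n t; apply: (le_trans (ler_normD _ _)); rewrite !normrM mulrDr.
    by apply: lerD; apply: ler_wpM2r => //; [exact: (B1 t).2|exact: (B2 t).2].
have fix1 x : u x = al + prim 0 (fun t => u t * a11 t + v t * a12 t) x.
  have /cvg_lim <- // : s1 n x @[n --> \oo] --> al + prim 0 (fun t => u t * a11 t + v t * a12 t) x.
  rewrite -cvg_shiftS/=; under eq_fun do rewrite (rec _ _).1.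
  by apply: cvgD; [exact: cvg_cst|exact: (lim _ _ I11 I12).2].
have fix2 x : v x = be + prim 0 (fun t => u t * a21 t + v t * a22 t) x.
  have /cvg_lim <- // : s2 n x @[n --> \oo] --> be + prim 0 (fun t => u t * a21 t + v t * a22 t) x.
  rewrite -cvg_shiftS/=; under eq_fun do rewrite (rec _ _).2.
  by apply: cvgD; [exact: cvg_cst|exact: (lim _ _ I21 I22).2].
exists u, v; split.
- by rewrite fix1 prim_base addr0.
- by rewrite fix2 prim_base addr0.
- by apply: eq_W11 (W11_prim al 0 (lim _ _ I11 I12).1) => // x; rewrite -fix1.
- by apply: eq_W11 (W11_prim be 0 (lim _ _ I21 I22).1) => // x; rewrite -fix2.
Qed.

End picard.
End linear_system.

(** * Periodic functions *)

Section periodicity.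
Variable R : realType.
Local Notation mu := (@lebesgue_measure R).
Implicit Types (f g h : R -> R) (A : set R) (a b c x : R).

(** The pushforward has the right values on half-open intervals, which determine Lebesgue
    measure. *)
Lemma lebesgue_measure_shift c A : measurable A ->
  pushforward mu ((fun x => x + c) : _ -> measurableTypeR R) A = mu A.
Proof.
move=> mA.
have mshift : measurable_fun setT
    ((fun x => x + c) : measurableTypeR R -> measurableTypeR R).
  exact: measurable_funD.
pose nu : {measure set (measurableTypeR R) -> \bar R} :=
  measure_function_pushforward__canonical__measure_function_Measure mu mshift.
apply/esym; apply: (@lebesgue_measure_unique R nu) => // _ [[a b]] _ <-.
rewrite /nu /= /pushforward.
have -> : (fun x : R => x + c) @^-1` `]a, b]%classic = `]a - c, b - c]%classic.
  by apply/seteqP; split=> x /=; rewrite !in_itv/= ltrBlDr lerBrDr.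
rewrite !lebesgue_measure_itv/= !lte_fin ltrD2r; case: ifP => // _.
by rewrite -!EFinD; congr (_%:E); ring.
Qed.

Lemma ge0_integral_shift f c a b : measurable_fun setT f -> (forall x, 0 <= f x) ->
  (\int[mu]_(x in `[(a + c)%R, (b + c)%R]) (f x)%:E = \int[mu]_(x in `[a, b]) (f (x + c)%R)%:E)%E.
Proof.
move=> mf f0.
have mshift : measurable_fun setT
    ((fun x => x + c) : measurableTypeR R -> measurableTypeR R).
  exact: measurable_funD.
have -> : `[a, b]%classic =
    ((fun x : measurableTypeR R => x + c) : _ -> measurableTypeR R) @^-1`
      `[a + c, b + c]%classic.
  by apply/seteqP; split=> x /=; rewrite !in_itv/= !lerD2r.
rewrite -(@ge0_integral_pushforward _ _ _ _ _ _ mshift mu _ (fun x => (f x)%:E))//=.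
- by apply: eq_measure_integral => //= A mA AS; exact/esym/lebesgue_measure_shift.
- by apply/measurable_EFinP; exact: measurable_funTS.
- by move=> y _; rewrite lee_fin.
Qed.

Section periodic.
Variable f : R -> R.
Hypotheses (mf : measurable_fun setT f) (f0 : forall x, 0 <= f x).
Hypotheses (fper : forall x, f (x + 1) = f x) (If : mu.-integrable `[0, 1] (EFin \o f)).

Lemma periodic_integral_nat (n : nat) a b :
  (\int[mu]_(x in `[(a + n%:R)%R, (b + n%:R)%R]) (f x)%:E = \int[mu]_(x in `[a, b]) (f x)%:E)%E.
Proof.
elim: n => [|n IHn]; first by rewrite !addr0.
by rewrite -natr1 !addrA ge0_integral_shift// -IHn; apply: eq_integral => x _; rewrite fper.
Qed.

Lemma periodic_Lloc1 : Lloc1 f.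
Proof.
have fin1 : (\int[mu]_(x in `[0%R, 1%R]) (f x)%:E < +oo)%E by exact: (integrable_lty _ If).
have Ipos a b : a = 0 -> forall n : nat, b = n%:R -> mu.-integrable `[a, b] (EFin \o f).
  move=> -> n ->; elim: n => [|n IHn].
    rewrite set_itv1; apply: integrableS If; [exact: measurable_itv|exact: measurable_set1|].
    by move=> x ->; rewrite /= in_itv/= lexx ler01.
  have n1 : 0 <= n.+1%:R :> R by rewrite ler0n.
  have n01 : n%:R <= n.+1%:R :> R by rewrite ler_nat.
  apply/integrableP; split; first by apply/measurable_EFinP; exact: measurable_funTS.
  under eq_integral => x _ do rewrite /= ger0_norm//.
  (* [[0, n+1]] is cut into [[0, n]] and []n, n+1]]; the second piece contributes at most the
     integral over [[n, n+1]], that is, over [[0, 1]]. *)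
  rewrite (@itv_bndbnd_setU _ _ _ (BRight n%:R)) ?bnd_simp ?ler0n//.
  rewrite ge0_integral_setU//=.
  - apply: lte_add_pinfty; first exact: (integrable_lty _ IHn).
    apply: le_lt_trans fin1.
    have := periodic_integral_nat n 0 1; rewrite add0r addrC natr1 => <-.
    apply: ge0_subset_integral => //.
    - by apply/measurable_EFinP; exact: measurable_funTS.
    - by move=> x _; rewrite lee_fin.
    - by apply: subset_itvr; rewrite bnd_simp.
  - by apply/measurable_EFinP; exact: measurable_funTS.
  - by move=> x _; rewrite lee_fin.
  - apply/disj_setPS => x [/=]; rewrite !in_itv/= => /andP[_ xn] /andP[].
    by rewrite ltNge xn.
move=> a b.
have [n [an bn]] : exists n : nat, - n%:R <= a /\ b <= n%:R.
  exists (Num.truncn (`|a| + `|b|)).+1.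
  have := ltW (truncnS_gt (`|a| + `|b|)) => nab.
  split; last by rewrite (le_trans (ler_norm _))// (le_trans _ nab)// lerDr.
  by rewrite lerNl (le_trans _ nab)// (le_trans (ler_norm _))// normrN lerDl.
apply: (@integrableS _ _ _ mu `[- n%:R, n%:R]%classic) => //.
  by apply: subset_itv; rewrite bnd_simp.
apply/integrableP; split; first by apply/measurable_EFinP; exact: measurable_funTS.
under eq_integral => x _ do rewrite /= ger0_norm//.
(* Translation by [n] carries [[-n, n]] to [[0, 2n]], settled above. *)
have := periodic_integral_nat n (- n%:R) n%:R; rewrite addNr -natrD => <-.
exact: (integrable_lty _ (Ipos 0 _ erefl (n + n)%N erefl)).
Qed.

Lemma periodic_integral_le (n : nat) d : 0 <= d <= 1 ->
  Rintegral mu `[n%:R, n%:R + d] f <= Rintegral mu `[0, 1] f /\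
  Rintegral mu `[- n%:R, - n%:R + d] f <= Rintegral mu `[0, 1] f.
Proof.
move=> /andP[d0 d1].
have e (a : R) : Rintegral mu `[a + n%:R, a + n%:R + d] f = Rintegral mu `[a, a + d] f.
  by rewrite /Rintegral addrAC periodic_integral_nat.
(* Both intervals are moved to [[0, d]], which lies in [[0, 1]]: the first with [a = 0], the second
   with [a = -n]. *)
have := e 0; rewrite !add0r => ->; have := e (- n%:R); rewrite addNr add0r => <-.
by split; apply: sub_itv_le_integral => //; exact: periodic_Lloc1.
Qed.

End periodic.
End periodicity.

(** * Local estimate *)

Section quasi_equation.
Variable R : realType.
Local Notation mu := (@lebesgue_measure R).
Implicit Types (f g h u v w z : R -> R) (a b c x y : R).

Lemma continuous_sqr u : continuous u -> continuous (fun x => u x ^+ 2).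
Proof. by move=> cu x; apply: cvgM; exact: cu. Qed.

Lemma continuous_norm u : continuous u -> continuous (fun x => `|u x|).
Proof. by move=> cu x; apply: cvg_norm; exact: cu. Qed.

(** [l_Q[u] = f] as a first-order system, with [v] the quasi-derivative [u' - Qu]. The derivatives
    are explicit formulas, so that identities between them reduce to [ring]. *)
Definition quasi_sol (Q u v f : R -> R) : Prop :=
  W11loc_deriv u (fun x => Q x * u x + v x) /\
  W11loc_deriv v (fun x => - Q x * v x - (Q x) ^+ 2 * u x - f x).

Lemma quasi_sol_lagrange Q u v f w z g : quasi_sol Q u v f -> quasi_sol Q w z g ->
  W11loc_deriv (fun x => u x * z x - v x * w x) (fun x => f x * w x - u x * g x).
Proof.
move=> [Du Dv] [Dw Dz].
by apply: eq_W11 (W11B (W11M Du Dz) (W11M Dv Dw)) => x //; ring.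
Qed.

(** Young's inequality [|g| <= (t g^2 + 1/t) / 2], integrated. The free parameter [t] is fixed
    later, once for [Q] and once for [f]. *)
Lemma itv_integral_norm_le g a d t : Lloc1 g -> Lloc1 (fun x => g x ^+ 2) ->
  0 < d -> 0 < t ->
  Rintegral mu `[a, a + d] (fun x => `|g x|) <=
    (t * Rintegral mu `[a, a + d] (fun x => g x ^+ 2) + d / t) / 2.
Proof.
move=> Ig Ig2 d0 t0.
have Ic := Lloc1_cst (t^-1 / 2 : R).
have -> : (t * Rintegral mu `[a, a + d] (fun x => g x ^+ 2) + d / t) / 2 =
    Rintegral mu `[a, a + d] (fun x => t / 2 * g x ^+ 2 + t^-1 / 2).
  rewrite itv_integralD//; last exact: Lloc1Z.
  by rewrite itv_integralZ// itv_integral_cst; [field; lra|lra].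
apply: itv_le_integral.
- exact: Lloc1_norm.
- by apply: Lloc1D => //; exact: Lloc1Z.
move=> x _; rewrite -(real_normK (num_real (g x))).
have := sqr_ge0 (t * `|g x| - 1); set y := `|g x| => H.
rewrite -subr_ge0 (_ : _ - y = (t * y - 1) ^+ 2 / (2 * t)); last by field; lra.
by rewrite divr_ge0//; lra.
Qed.

(** Otherwise [u^2 > s^2] on the whole interval, against the bound on the integral. *)
Lemma exists_small_value u a b s : continuous u -> a < b -> 0 < s ->
  Rintegral mu `[a, b] (fun x => u x ^+ 2) < s ^+ 2 * (b - a) ->
  exists2 x, a <= x <= b & `|u x| <= s.
Proof.
move=> cu ab s0 H; apply: contrapT => Hn.
suff : s ^+ 2 * (b - a) <= Rintegral mu `[a, b] (fun x => u x ^+ 2) by rewrite leNgt H.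
rewrite -(itv_integral_cst _ (ltW ab)); apply: itv_le_integral; first exact: Lloc1_cst.
  exact/Lloc1_cont/continuous_sqr.
move=> x xab; have [us|us] := leP `|u x| s; first by exfalso; apply: Hn; exists x.
by rewrite -[leRHS](real_normK (num_real _)) ler_sqr ?nnegrE ?(ltW s0)// ltW.
Qed.

Lemma norm_max u a b : continuous u -> a <= b ->
  exists2 c, a <= c <= b & forall t, a <= t <= b -> `|u t| <= `|u c|.
Proof.
move=> cu ab; have [|c cab cm] := @EVT_max R (fun x => `|u x|) a b ab.
  exact/continuous_subspaceT/continuous_norm.
by exists c; [rewrite in_itv in cab|move=> t tab; apply: cm; rewrite in_itv].
Qed.

(** [U] and [V] stand for the maxima of [|u|] and [|v|], [eta] and [K] for bounds on the integrals
    of [|Q|] and [Q^2]. Since [eta <= 1/14], the term [eta U] is absorbed and [U <= 2s + 2dV].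
    Inserted into the bound for [V], this leaves [V] with the factor [7 eta + 2Kd <= 1/2], absorbed
    in turn. *)
Lemma local_estimate_arith (U V s d K eta : R) :
  0 < d -> 0 < s -> 0 <= K -> 0 <= eta -> 0 <= U -> 0 <= V ->
  U <= s + (eta * U + d * V) ->
  (V - (eta * V + K * U + s)) * (d / 3) <= 2 * s + eta * U ->
  7 * eta + 2 * (K * d) <= 1 / 2 ->
  V <= 2 * s * (1 + 2 * K + 12 / d) /\
  U <= 2 * s + 2 * d * (2 * s * (1 + 2 * K + 12 / d)).
Proof.
move=> d0 s0 K0 eta0 U0 V0 hU hVo etaK.
have Kd0 : 0 <= K * d by rewrite mulr_ge0// ltW.
have hU2 : U <= 2 * s + 2 * (d * V).
  have : eta * U <= 1 / 2 * U by rewrite ler_wpM2r//; lra.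
  by clear hVo; lra.
have [r [r0 rd dE]] : exists r, [/\ 0 < r, r * d = 1 & d^-1 = r].
  by exists d^-1; split; rewrite ?invr_gt0// mulVf// gt_eqF.
rewrite dE; set osc := eta * V + K * U + s in hVo.
have h3 : V - osc <= 3 * r * (2 * s + eta * U).
  have -> : V - osc = 3 * r * ((V - osc) * (d / 3)).
    rewrite (_ : 3 * r * _ = (V - osc) * (r * d)); last by field.
    by rewrite rd mulr1.
  by apply: ler_wpM2l => //; rewrite mulr_ge0// ltW.
have h4 : eta * U <= eta * (2 * s + 2 * (d * V)) by exact: ler_wpM2l.
have h5 : K * U <= K * (2 * s + 2 * (d * V)) by exact: ler_wpM2l.
have h6 : 3 * r * (2 * s + eta * U) <= 3 * r * (2 * s + eta * (2 * s + 2 * (d * V))).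
  by apply: ler_wpM2l; [rewrite mulr_ge0// ltW|rewrite lerD2l].
have h7 : 3 * r * (2 * s + eta * (2 * s + 2 * (d * V))) =
    6 * (r * s) + 6 * ((r * s) * eta) + 6 * (eta * V) * (r * d) by ring.
rewrite rd mulr1 in h7.
have rs0 : 0 <= r * s by rewrite mulr_ge0 ?ltW.
have h8 : (r * s) * eta <= r * s by rewrite ler_piMr//; lra.
have h9 : (7 * eta + 2 * (K * d)) * V <= 1 / 2 * V by rewrite ler_wpM2r.
have h10 : K * (2 * s + 2 * (d * V)) = 2 * (K * s) + 2 * (K * d) * V by ring.
have h11 : (7 * eta + 2 * (K * d)) * V = 7 * (eta * V) + 2 * (K * d) * V by ring.
have hVf : V <= 2 * s * (1 + 2 * K + 12 * r).
  have -> : 2 * s * (1 + 2 * K + 12 * r) = 2 * s + 4 * (K * s) + 24 * (r * s) by ring.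
  move: h3 h5 h6 h7 h8 h9 h10 h11; rewrite /osc; clear; lra.
split=> //; rewrite (le_trans hU2)// lerD2l -mulrA ler_wpM2l// ler_wpM2l//; exact: ltW.
Qed.

(* On a short interval v is almost constant and u is small at two distant
   points, so that the mean of v, hence v itself, is small. *)
Lemma quasi_sol_local_estimate Q u v f a d s K eta x :
  0 < d -> 0 < s -> 0 <= K ->
  Lloc1 Q -> Lloc1 (fun x => Q x ^+ 2) -> Lloc1 f -> quasi_sol Q u v f ->
  Rintegral mu `[a, a + d] (fun x => `|Q x|) <= eta ->
  Rintegral mu `[a, a + d] (fun x => Q x ^+ 2) <= K ->
  Rintegral mu `[a, a + d] (fun x => `|f x|) <= s ->
  Rintegral mu `[a, a + d] (fun x => u x ^+ 2) <= s ^+ 2 * d / 6 ->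
  7 * eta + 2 * (K * d) <= 1 / 2 -> a <= x <= a + d ->
  `|v x| <= 2 * s * (1 + 2 * K + 12 / d) /\
  `|u x| <= 2 * s + 2 * d * (2 * s * (1 + 2 * K + 12 / d)).
Proof.
move=> d0 s0 K0 IQ IQ2 If [Wu Wv] Qeta QK fs us etaK xin.
have cu := W11_cont Wu; have cv := W11_cont Wv.
have ad : a <= a + d by lra.
have eta0 : 0 <= eta by apply: le_trans Qeta; apply: itv_integral_ge0.
have [xu uin hu] := norm_max cu ad; have [xv vin hv] := norm_max cv ad.
set U := `|u xu| in hu *; set V := `|v xv| in hv *.
have U0 : 0 <= U by exact: normr_ge0.
have V0 : 0 <= V by exact: normr_ge0.
have sub g p q : Lloc1 g -> (forall t, 0 <= g t) -> a <= p -> q <= a + d ->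
    Rintegral mu `[p, q] g <= Rintegral mu `[a, a + d] g.
  by move=> Ig g0 ap qd; exact: sub_itv_le_integral.
(* The equation [u' = Qu + v] bounds the oscillation of [u]; the second equation then does the same
   for [v]. *)
have osc_u p q : a <= p -> p <= q -> q <= a + d -> `|u q - u p| <= eta * U + d * V.
  move=> ap pq qd; rewrite (W11_increment Wu pq).
  have I1 := Lloc1Z U (Lloc1_norm IQ).
  apply: (@le_trans _ _ (Rintegral mu `[p, q] (fun t => U * `|Q t| + V))).
    apply: itv_le_norm_integral; first by case: Wu.
      by apply: Lloc1D => //; exact: Lloc1_cst.
    move=> t /andP[pt tq]; have tin : a <= t <= a + d by apply/andP; split; lra.
    rewrite (le_trans (ler_normD _ _))// normrM mulrC lerD//; last exact: hv.
    by rewrite ler_wpM2r//; exact: hu.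
  rewrite itv_integralD//; last exact: Lloc1_cst.
  rewrite itv_integral_cst// lerD//.
    rewrite itv_integralZ; last exact: Lloc1_norm.
    rewrite mulrC ler_wpM2r// (le_trans _ Qeta)//.
    by apply: sub => //; exact: Lloc1_norm.
  by rewrite mulrC ler_wpM2r//; lra.
have osc_v p q : a <= p -> p <= q -> q <= a + d -> `|v q - v p| <= eta * V + K * U + s.
  move=> ap pq qd; rewrite (W11_increment Wv pq).
  have I1 := Lloc1Z V (Lloc1_norm IQ); have I2 := Lloc1Z U IQ2.
  have I3 := Lloc1_norm If.
  apply: (@le_trans _ _ (Rintegral mu `[p, q] (fun t => V * `|Q t| + U * Q t ^+ 2 + `|f t|))).
    apply: itv_le_norm_integral; first by case: Wv.
      by apply: Lloc1D => //; exact: Lloc1D.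
    move=> t /andP[pt tq]; have tin : a <= t <= a + d by apply/andP; split; lra.
    rewrite (le_trans (ler_normB _ _))// lerD// (le_trans (ler_normB _ _))// lerD//.
      by rewrite normrM normrN mulrC ler_wpM2r//; exact: hv.
    by rewrite normrM ger0_norm ?sqr_ge0// mulrC ler_wpM2r ?sqr_ge0//; exact: hu.
  rewrite itv_integralD//; last exact: Lloc1D.
  rewrite itv_integralD// lerD//; last first.
    by rewrite (le_trans _ fs)//; exact: sub.
  rewrite lerD// itv_integralZ//; try exact: Lloc1_norm.
    rewrite mulrC ler_wpM2r// (le_trans _ Qeta)//.
    by apply: sub => //; exact: Lloc1_norm.
  rewrite mulrC ler_wpM2r// (le_trans _ QK)//.
  by apply: sub => // t; exact: sqr_ge0.
have Iu2 : Lloc1 (fun x => u x ^+ 2).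
  exact/Lloc1_cont/continuous_sqr.
have s2 : 0 < s ^+ 2 by rewrite exprn_gt0.
(* On a third of the interval the threshold for a value at most [s] is [s^2 d / 3]; the hypothesis
   gives half of it, so the inequality is strict. *)
have small p q : a <= p -> q <= a + d -> q - p = d / 3 -> exists2 t, p <= t <= q & `|u t| <= s.
  move=> ap qd pq; apply: exists_small_value => //; first by lra.
  apply: (@le_lt_trans _ _ (s ^+ 2 * d / 6)).
    apply: le_trans us; apply: sub => // t; exact: sqr_ge0.
  rewrite pq; nra.
(* One point in the first third and one in the last: they are at least [d / 3] apart. *)
have [x1 /andP[ax1 x1d] ux1] : exists2 t, a <= t <= a + d / 3 & `|u t| <= s.
  by apply: small; lra.
have [x2 /andP[dx2 x2d] ux2] : exists2 t, a + 2 * d / 3 <= t <= a + d & `|u t| <= s.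
  by apply: small; lra.
have hU : U <= s + (eta * U + d * V).
  move/andP: uin => [axu xud].
  rewrite [leLHS](_ : U = `|u x1 + (u xu - u x1)|); last by rewrite addrC subrK.
  rewrite (le_trans (ler_normD _ _))// lerD//.
  case: (leP x1 xu) => [|/ltW] xx; last rewrite distrC; apply: osc_u; lra.
set osc := eta * V + K * U + s in osc_v.
have x12 : x1 <= x2 by lra.
(* The integral of [v] over [[x1, x2]] is [u x2 - u x1] minus that of [Qu], hence small; replacing
   [v] by its value at [xv] costs at most [osc] times the length. *)
have hV : V * (x2 - x1) <= 2 * s + eta * U + osc * (x2 - x1).
  have Iv : Lloc1 v := Lloc1_cont cv.
  have I1 := Lloc1Z U (Lloc1_norm IQ).
  have hv1 : `|Rintegral mu `[x1, x2] v| <= 2 * s + eta * U.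
    have -> : Rintegral mu `[x1, x2] v =
        (u x2 - u x1) - Rintegral mu `[x1, x2] (fun t => Q t * u t).
      rewrite (W11_increment Wu x12) itv_integralD//; first by ring.
      apply: (@eq_Lloc1 _ (fun t => u t * Q t)) => [t|]; first by rewrite mulrC.
      exact: Lloc1_contM.
    rewrite (le_trans (ler_normB _ _))// lerD//.
      by rewrite (le_trans (ler_normB _ _))//; lra.
    apply: (@le_trans _ _ (Rintegral mu `[x1, x2] (fun t => U * `|Q t|))).
      apply: itv_le_norm_integral => //.
        apply: (@eq_Lloc1 _ (fun t => u t * Q t)) => [t|]; first by rewrite mulrC.
        exact: Lloc1_contM.
      move=> t /andP[pt tq]; have tin : a <= t <= a + d by apply/andP; split; lra.
      by rewrite normrM mulrC ler_wpM2r//; exact: hu.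
    rewrite itv_integralZ; last exact: Lloc1_norm.
    rewrite mulrC ler_wpM2r// (le_trans _ Qeta)//.
    by apply: sub => //; try exact: Lloc1_norm; lra.
  have e : v xv * (x2 - x1) = Rintegral mu `[x1, x2] v +
      Rintegral mu `[x1, x2] (fun t => v xv - v t).
    rewrite -itv_integralD//; last by apply: Lloc1B => //; exact: Lloc1_cst.
    rewrite -itv_integral_cst//; apply: eq_itv_integral => t _; by rewrite addrC subrK.
  have : `|v xv * (x2 - x1)| <= 2 * s + eta * U + osc * (x2 - x1).
    rewrite e (le_trans (ler_normD _ _))// lerD// -itv_integral_cst//.
    apply: itv_le_norm_integral; [|exact: Lloc1_cst|].
      by apply: Lloc1B => //; exact: Lloc1_cst.
    move=> t /andP[pt tq]; move/andP: vin => [axv xvd].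
    case: (leP t xv) => [|/ltW] xx; last rewrite distrC; apply: osc_v; lra.
  by rewrite normrM (ger0_norm (_ : 0 <= x2 - x1))//; lra.
have hVo : (V - osc) * (d / 3) <= 2 * s + eta * U.
  (* [x2 - x1] may be lowered to [d / 3] only if [V - osc] is positive; otherwise the left side is
     at most 0. *)
  have [Vo|Vo] := leP (V - osc) 0.
    apply: (@le_trans _ _ 0); last by rewrite addr_ge0 ?mulr_ge0// ltW.
    by rewrite mulr_le0_ge0// divr_ge0// ltW.
  apply: (@le_trans _ _ ((V - osc) * (x2 - x1))); first by apply: ler_wpM2l; [exact: ltW|lra].
  by rewrite mulrBl; lra.
have [bV bU] := local_estimate_arith d0 s0 K0 eta0 U0 V0 hU hVo etaK.
by split; [apply: le_trans (hv _ xin) bV|apply: le_trans (hu _ xin) bU].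
Qed.

End quasi_equation.

(** * Symmetry *)

Section symmetry.
Variable R : realType.
Local Notation mu := (@lebesgue_measure R).
Implicit Types (Q f g h u v w z : R -> R) (a b c x y d e : R).

Lemma integrable_Lloc1 h : mu.-integrable setT (EFin \o h) -> Lloc1 h.
Proof. by move=> Ih a b; apply: integrableS Ih. Qed.

Lemma Rintegral_itv_cvg h : mu.-integrable setT (EFin \o h) ->
  Rintegral mu `[- n%:R, n%:R] h @[n --> \oo] --> Rintegral mu setT h.
Proof.
move=> Ih; have mh := integrable_fun_measurable Ih.
under eq_fun do rewrite Rintegral_mkcond.
have [] // := @Rintegral_dominated_cvg R setT
  (fun n => h \_ `[- n%:R, n%:R]%classic) h (fun x => `|h x|).
- by move=> n; apply/(measurable_restrictT _ _).1 => //; exact: measurable_funTS.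
- move=> x _; apply: cvg_near_cst.
  exists (Num.truncn `|x|).+1 => // n /= xn; rewrite patchE ifT// inE/= in_itv/= -ler_norml.
  by rewrite (le_trans (ltW (truncnS_gt _)))// ler_nat.
- by have /integrable_abse := Ih.
- by move=> n x _; rewrite patchE; case: ifP => // _; rewrite normr0.
Qed.

Lemma integral_tail_small h d e : mu.-integrable setT (EFin \o h) ->
  (forall x, 0 <= h x) -> d <= 1 -> 0 < e ->
  \forall n \near \oo, Rintegral mu `[n%:R, n%:R + d] h <= e /\
    Rintegral mu `[- n%:R, - n%:R + d] h <= e.
Proof.
move=> Ih h0 d1 e0; have Il := integrable_Lloc1 Ih.
have e2 : 0 < e / 2 by rewrite divr_gt0.
have /cvgrPdist_le/(_ _ e2)[N _ HN] := Rintegral_itv_cvg Ih.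
have step n : (N <= n)%N -> Rintegral mu `[n%:R, n%:R + 1] h <= e /\
    Rintegral mu `[- n.+1%:R, - n%:R] h <= e.
  move=> Nn; have := HN _ Nn; have := HN _ (leqW Nn); rewrite /= !ler_norml.
  have n0 : 0 <= n%:R :> R by [].
  have n1 : n.+1%:R = n%:R + 1 :> R by rewrite natr1.
  rewrite (@integral_chasles _ h (- n.+1%:R) (- n%:R))//; [|lra|lra].
  rewrite (@integral_chasles _ h (- n%:R) n%:R n.+1%:R)//; [|lra|lra].
  have p1 : 0 <= Rintegral mu `[n%:R, n.+1%:R] h by exact: itv_integral_ge0.
  have p2 : 0 <= Rintegral mu `[- n.+1%:R, - n%:R] h by exact: itv_integral_ge0.
  rewrite -n1 => /andP[H1 H2] /andP[H3 H4]; split; lra.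
(* On the negative side [[-(n+1), -(n+1)+d]] lies in the interval added in passing from [n] to
   [n+1], one index earlier than on the positive side, hence [N.+1]. *)
exists N.+1 => // -[//|n] /= Nn; split.
  have [] := step _ (leqW Nn); move=> + _; apply: le_trans.
  by apply: sub_itv_le_integral => //; rewrite lerD2l.
have [_] := step _ Nn; apply: le_trans.
by apply: sub_itv_le_integral => //; rewrite -natr1; lra.
Qed.

Lemma quasi_sol_decay Q u v f K : 0 <= K ->
  Lloc1 Q -> Lloc1 (fun x => Q x ^+ 2) ->
  (forall n d, 0 <= d <= 1 ->
    Rintegral mu `[n%:R, n%:R + d] (fun x => Q x ^+ 2) <= K /\
    Rintegral mu `[- n%:R, - n%:R + d] (fun x => Q x ^+ 2) <= K) ->
  quasi_sol Q u v f -> L2 u -> L2 f ->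
  [/\ u n%:R @[n --> \oo] --> 0, v n%:R @[n --> \oo] --> 0,
      u (- n%:R) @[n --> \oo] --> 0 & v (- n%:R) @[n --> \oo] --> 0].
Proof.
move=> K0 IQ IQ2 QK uvf [mu_ Iu] [mf If].
have half (A y s : R) : A <= y / 6 -> y <= s -> 0 < s -> (A + s) / 2 <= s by lra.
have If2 := integrable_Lloc1 If; have If1 := Lloc1_sqr mf If2.
(* With [eta = (tK + d/t) / 2], this choice gives [tK <= 1/28] and [d/t = 1/28], so [7 eta <= 1/4]
   and [2Kd <= 1/4]: the smallness condition of the local estimate. *)
pose t : R := (28 * (K + 1))^-1; pose d := t / 28.
have t0 : 0 < t by rewrite invr_gt0; lra.
have tK : t * (28 * (K + 1)) = 1 by rewrite mulVf//; lra.
have d0 : 0 < d by rewrite divr_gt0.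
have Kt0 : 0 <= K * t by rewrite mulr_ge0// ltW.
have d1 : d <= 1 by rewrite /d; lra.
have etaK : 7 * ((t * K + d / t) / 2) + 2 * (K * d) <= 1 / 2.
  rewrite (_ : d / t = 28^-1); last by rewrite /d; field; lra.
  by rewrite /d; lra.
(* The local estimate reads [|v| <= C s] and [|u| <= C' s], so [s = e / (1 + C + C')] brings both
   below [e]. *)
pose C := 2 * (1 + 2 * K + 12 / d); pose C' := 2 + 2 * d * C.
have C0 : 0 <= C by rewrite /C mulr_ge0// !addr_ge0 ?mulr_ge0// invr_ge0 ltW.
have C'0 : 0 <= C'.
  by apply: addr_ge0 => //; apply: mulr_ge0 => //; apply: mulr_ge0 => //; exact: ltW.
have key e : 0 < e -> \forall n \near \oo,
    (`|u n%:R| <= e /\ `|v n%:R| <= e) /\ (`|u (- n%:R)| <= e /\ `|v (- n%:R)| <= e).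
  move=> e0; pose s := e / (1 + C + C').
  have CC : 0 < 1 + C + C' by lra.
  have s0 : 0 < s by rewrite divr_gt0.
  have sE : s * (1 + C + C') = e by rewrite /s divfK// gt_eqF.
  have sC : s * C <= e by rewrite -sE ler_wpM2l ?ltW//; lra.
  have sC' : s * C' <= e by rewrite -sE ler_wpM2l ?ltW//; lra.
  have r0 : 0 < s ^+ 2 * d / 6 by rewrite divr_gt0// mulr_gt0// exprn_gt0.
  have loc a : Rintegral mu `[a, a + d] (fun x => Q x ^+ 2) <= K ->
      Rintegral mu `[a, a + d] (fun x => u x ^+ 2) <= s ^+ 2 * d / 6 ->
      Rintegral mu `[a, a + d] (fun x => f x ^+ 2) <= s ^+ 2 * d / 6 ->
      `|u a| <= e /\ `|v a| <= e.
    move=> aK au af.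
    have HQ : Rintegral mu `[a, a + d] (fun x => `|Q x|) <= (t * K + d / t) / 2.
      apply: (le_trans (itv_integral_norm_le a IQ IQ2 d0 t0)).
      by rewrite ler_wpM2r// lerD2r ler_wpM2l// ltW.
    have Hf : Rintegral mu `[a, a + d] (fun x => `|f x|) <= s.
      (* With parameter [d / s] Young's inequality gives at most [(s d^2 / 6 + s) / 2], which is
         below [s] as [d <= 1]. *)
      have T0 : 0 < d / s by rewrite divr_gt0.
      apply: (le_trans (itv_integral_norm_le a If1 If2 d0 T0)).
      have h1 : d / s * Rintegral mu `[a, a + d] (fun x => f x ^+ 2) <= d / s * (s ^+ 2 * d / 6).
        by rewrite ler_wpM2l// ltW.
      have h2 : d / s * (s ^+ 2 * d / 6) = s * d * d / 6 by field; lra.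
      have h3 : d / (d / s) = s by field; lra.
      have h4 : s * d * d <= s.
        by rewrite -mulrA; apply: ler_piMr; [exact: ltW|apply: mulr_ile1 => //; exact: ltW].
      rewrite h2 in h1; rewrite h3; exact: half h1 h4 s0.
    have ain : a <= a <= a + d by apply/andP; split; lra.
    have [h1 h2] := quasi_sol_local_estimate d0 s0 K0 IQ IQ2 If1 uvf HQ aK Hf au etaK ain.
    split.
      by rewrite (le_trans h2)// (le_trans _ sC')// le_eqVlt; apply/orP; left; apply/eqP;
        rewrite /C' /C; ring.
    by rewrite (le_trans h1)// (le_trans _ sC)// le_eqVlt; apply/orP; left; apply/eqP;
      rewrite /C; ring.
  near=> n.
  have [Qp Qn] : Rintegral mu `[n%:R, n%:R + d] (fun x => Q x ^+ 2) <= K /\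
      Rintegral mu `[- n%:R, - n%:R + d] (fun x => Q x ^+ 2) <= K.
    by apply: QK; rewrite d1 ltW.
  have [up un] : Rintegral mu `[n%:R, n%:R + d] (fun x => u x ^+ 2) <= s ^+ 2 * d / 6 /\
      Rintegral mu `[- n%:R, - n%:R + d] (fun x => u x ^+ 2) <= s ^+ 2 * d / 6.
    near: n; apply: integral_tail_small => // x; exact: sqr_ge0.
  have [fp fn] : Rintegral mu `[n%:R, n%:R + d] (fun x => f x ^+ 2) <= s ^+ 2 * d / 6 /\
      Rintegral mu `[- n%:R, - n%:R + d] (fun x => f x ^+ 2) <= s ^+ 2 * d / 6.
    near: n; apply: integral_tail_small => // x; exact: sqr_ge0.
  by split; exact: loc.
by split; apply/cvgrPdist_le => e e0; apply: filterS (key e e0) => n [[? ?] [? ?]];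
  rewrite sub0r normrN.
Unshelve. all: by end_near. Qed.

Lemma ae_eq_L2 u w : measurable_fun setT w -> {ae mu, forall x, u x = w x} -> L2 u -> L2 w.
Proof.
move=> mw uw [mu_ Iu]; split => //.
apply: (@ae_eq_integrable _ setT (fun x => u x ^+ 2) (fun x => w x ^+ 2)) => //.
- exact: measurable_funX.
- exact: measurable_funX.
- by apply: ae_imply uw => x ->.
Qed.

(** The continuous representative [ut] replaces [u], and the almost everywhere relations are
    absorbed by changing the derivatives on null sets. *)
Lemma SmaxR_quasi_sol Q u f : measurable_fun setT Q -> SmaxR Q u f ->
  exists ut v, [/\ L2 ut, L2 f, {ae mu, forall x, u x = ut x} & quasi_sol Q ut v f].
Proof.
move=> mQ [Lu [Lf [ut [du [v [dv [uut [Wu [Wv [vE fE]]]]]]]]]].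
have mut := continuous_measurable_fun (W11_cont Wu).
have mv := continuous_measurable_fun (W11_cont Wv).
exists ut, v; split => //; first exact: ae_eq_L2 Lu.
split; [apply: ae_eq_W11 Wu|apply: ae_eq_W11 Wv].
- by apply: measurable_funD => //; exact: measurable_funM.
- by apply: ae_imply vE => x ->; ring.
- apply: measurable_funB; last by case: Lf.
  apply: measurable_funB; apply: measurable_funM => //.
    exact: measurableT_comp.
  exact: measurable_funX.
- by apply: ae_imply fE => x ->; ring.
Qed.

Lemma quasi_sol_SmaxR Q u ut v f : L2 u -> L2 f -> {ae mu, forall x, u x = ut x} ->
  quasi_sol Q ut v f -> SmaxR Q u f.
Proof.
move=> Lu Lf uE [Wu Wv]; split=> //; split=> //.
exists ut, (fun x => Q x * ut x + v x), v, (fun x => - Q x * v x - Q x ^+ 2 * ut x - f x).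
do 3 split => //; split; apply: aeW => x; ring.
Qed.

Lemma L2_mul u w : L2 u -> L2 w -> mu.-integrable setT (fun x => (u x * w x)%:E).
Proof. by move=> [mu_ Iu] [mw Iw]; exact: integrable_mul_sqr. Qed.

Lemma SmaxR_symmetric Q K u f w g : 0 <= K -> measurable_fun setT Q ->
  Lloc1 (fun x => Q x ^+ 2) ->
  (forall n d, 0 <= d <= 1 ->
    Rintegral mu `[n%:R, n%:R + d] (fun x => Q x ^+ 2) <= K /\
    Rintegral mu `[- n%:R, - n%:R + d] (fun x => Q x ^+ 2) <= K) ->
  SmaxR Q u f -> SmaxR Q w g ->
  Rintegral mu setT (fun x => f x * w x) = Rintegral mu setT (fun x => u x * g x).
Proof.
move=> K0 mQ IQ2 QK Suf Swg; have IQ := Lloc1_sqr mQ IQ2.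
have [mu_ _] := Suf.1; have [mw _] := Swg.1.
have [ut [v [Lu Lf uE uS]]] := SmaxR_quasi_sol mQ Suf.
have [wt [z [Lw Lg wE wS]]] := SmaxR_quasi_sol mQ Swg.
have [mf _] := Lf; have [mg _] := Lg; have [mut _] := Lu; have [mwt _] := Lw.
have -> : Rintegral mu setT (fun x => f x * w x) = Rintegral mu setT (fun x => f x * wt x).
  apply: ae_eq_Rintegral => //; try exact: measurable_funM.
  by apply: ae_imply wE => x ->.
have -> : Rintegral mu setT (fun x => u x * g x) = Rintegral mu setT (fun x => ut x * g x).
  apply: ae_eq_Rintegral => //; try exact: measurable_funM.
  by apply: ae_imply uE => x ->.
have I1 := L2_mul Lf Lw; have I2 := L2_mul Lu Lg.
apply/eqP; rewrite -subr_eq0 -RintegralB//; apply/eqP.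
have W := quasi_sol_lagrange uS wS.
have [u1 v1 u2 v2] := quasi_sol_decay K0 IQ IQ2 QK uS Lu Lf.
have [w1 z1 w2 z2] := quasi_sol_decay K0 IQ IQ2 QK wS Lw Lg.
have IB : mu.-integrable setT (EFin \o (fun x => f x * wt x - ut x * g x)).
  exact: (integrableB _ I1 I2).
have /cvg_lim <- // := Rintegral_itv_cvg IB.
apply/cvg_lim => //.
(* By the Lagrange identity only boundary values at [n] and [-n] remain, and each factor in them
   tends to 0. *)
have -> : (fun n : nat => Rintegral mu `[- n%:R, n%:R] (fun x => f x * wt x - ut x * g x)) =
    (fun n : nat => (ut n%:R * z n%:R - v n%:R * wt n%:R) -
      (ut (- n%:R) * z (- n%:R) - v (- n%:R) * wt (- n%:R))).
  by apply/funext => n; rewrite -(W11_increment W)// lerNl (le_trans _ (ler0n _ _))// oppr_le0.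
have -> : (0 : R) = (0 * 0 - 0 * 0) - (0 * 0 - 0 * 0) by ring.
by apply: cvgB; apply: cvgB; apply: cvgM.
Qed.

End symmetry.

(** * The adjoint *)

Section adjoint.
Variable R : realType.
Local Notation mu := (@lebesgue_measure R).
Implicit Types (Q f g h u v w z c s : R -> R) (a b x y N : R).

(** The class that contains the difference of an L_2 function and a continuous one, which need not
    be in L_2. *)
Definition L2loc f := measurable_fun setT f /\ Lloc1 (fun x => f x ^+ 2).

Lemma L2loc_cont f : continuous f -> L2loc f.
Proof.
move=> cf; split; first exact: continuous_measurable_fun.
exact/Lloc1_cont/continuous_sqr.
Qed.

Lemma L2loc_contM h f : continuous h -> L2loc f -> L2loc (fun x => h x * f x).
Proof.
move=> ch [mf If]; split; first by apply: measurable_funM => //; exact: continuous_measurable_fun.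
apply: (@eq_Lloc1 _ (fun x => h x ^+ 2 * f x ^+ 2)) => [x|]; first by rewrite exprMn.
by apply: Lloc1_contM => //; exact: continuous_sqr.
Qed.

Lemma L2locZ a f : L2loc f -> L2loc (fun x => a * f x).
Proof. by apply: L2loc_contM => x; exact: cvg_cst. Qed.

Lemma L2loc_mul f g : L2loc f -> L2loc g -> Lloc1 (fun x => f x * g x).
Proof. by move=> [mf If] [mg Ig]; exact: Lloc1_mul_sqr. Qed.

Lemma L2locB f g : L2loc f -> L2loc g -> L2loc (fun x => f x - g x).
Proof.
move=> Lf Lg; split; first by apply: measurable_funB; [case: Lf|case: Lg].
apply: (@eq_Lloc1 _ (fun x => f x ^+ 2 + g x ^+ 2 - 2 * (f x * g x))) => [x|]; first by ring.
apply: Lloc1B; first by apply: Lloc1D; [case: Lf|case: Lg].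
by apply: Lloc1Z; exact: L2loc_mul.
Qed.

Lemma L2_L2loc f : L2 f -> L2loc f.
Proof. by move=> [mf If]; split=> //; exact: integrable_Lloc1. Qed.

Lemma L2loc_Lloc1 f : L2loc f -> Lloc1 f.
Proof. by move=> [mf If]; exact: Lloc1_sqr. Qed.

Lemma integral_supp g N : Lloc1 g -> (forall x, N <= `|x| -> g x = 0) ->
  mu.-integrable setT (EFin \o g) /\ Rintegral mu setT g = Rintegral mu `[- N, N] g.
Proof.
move=> Ig g0.
have gE : g \_ `[- N, N]%classic = g.
  apply/funext => x; rewrite patchE; case: ifPn => // xN; rewrite g0//.
  rewrite leNgt; apply: contra xN => xN; rewrite inE/= in_itv/= -ler_norml; exact: ltW.
split; last by rewrite [RHS]Rintegral_mkcond gE.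
suff : mu.-integrable setT ((EFin \o g) \_ `[- N, N]%classic) by rewrite restrict_EFin gE.
by apply/(integrable_mkcond _ _).1; [exact: measurable_itv|exact: Ig].
Qed.

Lemma L2_supp f N : L2loc f -> (forall x, N <= `|x| -> f x = 0) -> L2 f.
Proof.
move=> [mf If] f0; split=> //.
have f20 x : N <= `|x| -> f x ^+ 2 = 0 by move=> xN; rewrite f0// expr0n.
by have [] := integral_supp If f20.
Qed.

Lemma itv_integral_supp g N N' : Lloc1 g -> (forall x, N <= `|x| -> g x = 0) -> N <= N' ->
  Rintegral mu `[- N', N'] g = Rintegral mu `[- N, N] g.
Proof.
move=> Ig g0 NN.
have [_ <-] := integral_supp Ig g0.
by have [_ <-] := integral_supp Ig (fun x xN => g0 x (le_trans NN xN)).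
Qed.

Lemma itv_integral_eq0 g a b : (forall x, a <= x <= b -> g x = 0) -> Rintegral mu `[a, b] g = 0.
Proof.
move=> g0; rewrite (@eq_itv_integral _ _ (fun=> 0 * 0)) => [|x xab]; last by rewrite g0// mul0r.
by rewrite itv_integralZ ?mul0r//; exact: Lloc1_cst.
Qed.

(** Left of [-N] there is nothing to integrate; right of [N] the primitive is the whole integral,
    which vanishes. *)
Lemma prim_supp_eq0 g N x : Lloc1 g -> (forall x, N <= `|x| -> g x = 0) ->
  0 <= N -> Rintegral mu `[- N, N] g = 0 -> N <= `|x| -> prim (- N) g x = 0.
Proof.
move=> Ig g0 N0 gN; rewrite ler_normr => /orP[Nx|Nx].
  have := primB (- N) Ig (_ : - N <= x); rewrite prim_base subr0 => ->; last by lra.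
  rewrite (@integral_chasles _ _ _ N)// ?gN ?add0r; last by lra.
  by apply: itv_integral_eq0 => y /andP[Ny _]; rewrite g0// ler_normr Ny.
have xN : x <= - N by lra.
have E := primB (- N) Ig xN; rewrite prim_base sub0r in E.
apply/eqP; rewrite -oppr_eq0 E itv_integral_eq0// => y /andP[_ yN].
by rewrite g0// ler_normr; apply/orP; right; lra.
Qed.

Lemma continuous_integral_eq0 g a b x : continuous g -> (forall y, 0 <= g y) ->
  Rintegral mu `[a, b] g = 0 -> a < x < b -> g x = 0.
Proof.
move=> cg g0 gab /andP[ax xb]; apply/eqP; rewrite eq_le g0 andbT leNgt; apply/negP => gx.
have gx2 : 0 < g x / 2 by lra.
have /cvgrPdist_lt/(_ _ gx2)[d /= d0 Hd] := cg x.
(* [[x, x + e]] stays inside [[a, b]] and in the neighbourhood where [g] exceeds [g x / 2]. *)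
pose e := Num.min (d / 2) (b - x).
have e0 : 0 < e by rewrite lt_min; apply/andP; split; lra.
have ed : e <= d / 2 by rewrite ge_min lexx.
have eb : e <= b - x by rewrite ge_min lexx orbT.
have Ig := Lloc1_cont cg.
suff : g x / 2 * e <= 0 by rewrite leNgt mulr_gt0.
rewrite -gab; have -> : g x / 2 * e = Rintegral mu `[x, x + e] (fun=> g x / 2).
  by rewrite itv_integral_cst; [congr (_ * _); ring|lra].
apply: (@le_trans _ _ (Rintegral mu `[x, x + e] g)).
  apply: itv_le_integral => //; first exact: Lloc1_cst.
  move=> y /andP[xy ye].
  have xyd : `|x - y| < d by rewrite ltr_norml; apply/andP; split; lra.
  by have := Hd y xyd; rewrite /= ltr_norml => /andP[_ H]; lra.
by apply: sub_itv_le_integral => //; lra.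
Qed.

Lemma ae_foralln (P : nat -> R -> Prop) : (forall n, {ae mu, forall x, P n x}) ->
  {ae mu, forall x, forall n, P n x}.
Proof.
move=> aeP; have := negligible_bigcup aeP; apply: negligibleS => x /=.
by move=> /existsNP[n nP]; exists n.
Qed.

Lemma ae_eq0_of_integral g : (forall x, 0 <= g x) -> mu.-integrable setT (EFin \o g) ->
  Rintegral mu setT g = 0 -> {ae mu, forall x, g x = 0}.
Proof.
move=> g0 Ig gI.
have : ae_eq mu setT (EFin \o g) (cst 0%E).
  apply/(ae_eq_integral_abs mu measurableT).
    by apply/measurable_EFinP; exact: integrable_fun_measurable Ig.
  under eq_integral => x _ do rewrite /= ger0_norm//.
  have : (\int[mu]_x (EFin \o g) x)%E = (Rintegral mu setT g)%:E.
    by rewrite /Rintegral fineK//; apply: integrable_fin_num => //; exact: measurableT.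
  by rewrite gI.
by apply: ae_imply => x /(_ I) [].
Qed.

(** * Solution space and variation of constants *)

Lemma quasi_solD Q u v f w z g : quasi_sol Q u v f -> quasi_sol Q w z g ->
  quasi_sol Q (fun x => u x + w x) (fun x => v x + z x) (fun x => f x + g x).
Proof.
move=> [Wu Wv] [Ww Wz]; split.
  by apply: eq_W11 (W11D Wu Ww) => x //; ring.
by apply: eq_W11 (W11D Wv Wz) => x //; ring.
Qed.

Lemma quasi_solZ Q a u v f : quasi_sol Q u v f ->
  quasi_sol Q (fun x => a * u x) (fun x => a * v x) (fun x => a * f x).
Proof.
move=> [Wu Wv]; split.
  by apply: eq_W11 (W11Z a Wu) => x //; ring.
by apply: eq_W11 (W11Z a Wv) => x //; ring.
Qed.

Lemma eq_quasi_sol Q u v f g : f =1 g -> quasi_sol Q u v f -> quasi_sol Q u v g.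
Proof. by move=> /funext ->. Qed.

(** A tent, positive exactly on []-N, N[]: a continuous weight of compact support in place of an
    indicator function. *)
Definition bump N x := Num.max 0 (N - `|x|).

Lemma bump_continuous N : continuous (bump N).
Proof.
move=> x; apply: (@continuous_max _ _ (fun=> 0) (fun y => N - `|y|)); first exact: cvg_cst.
by apply: cvgB; [exact: cvg_cst|exact: norm_continuous].
Qed.

Lemma bump_ge0 N x : 0 <= bump N x.
Proof. by rewrite /bump le_max lexx. Qed.

Lemma bump_gt0 N x : `|x| < N -> 0 < bump N x.
Proof. by move=> xN; rewrite /bump lt_max subr_gt0 xN orbT. Qed.

Lemma bump_eq0 N x : N <= `|x| -> bump N x = 0.
Proof. by move=> xN; rewrite /bump max_l// subr_le0. Qed.

(** Initial values [(1, 0)] and [(0, 1)]. For vanishing right-hand sides the Lagrange identity makes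
    the Wronskian constant, and it is 1 at 0. *)
Lemma quasi_sol_fundamental Q : Lloc1 Q -> Lloc1 (fun x => Q x ^+ 2) ->
  exists c c1 s s1, [/\ quasi_sol Q c c1 (fun=> 0), quasi_sol Q s s1 (fun=> 0),
    c 0 = 1 /\ c1 0 = 0, s 0 = 0 /\ s1 0 = 1 & forall x, c x * s1 x - c1 x * s x = 1].
Proof.
move=> IQ IQ2.
have sol al be : exists u v, [/\ u 0 = al, v 0 = be & quasi_sol Q u v (fun=> 0)].
  have [u [v [u0 v0 Wu Wv]]] :=
    linear_system_solution al be IQ (Lloc1_cst 1) (Lloc1N IQ2) (Lloc1N IQ).
  exists u, v; split=> //; split.
    by apply: eq_W11 Wu => // x; ring.
  by apply: eq_W11 Wv => // x; ring.
have [c [c1 [c0 c10 cs]]] := sol 1 0; have [s [s1 [s0 s10 ss]]] := sol 0 1.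
exists c, c1, s, s1; split=> //.
apply: (@W11_eq _ _ (fun=> 1) (fun=> 0) 0); last by rewrite c0 c10 s0 s10; ring.
  by apply: eq_W11 (quasi_sol_lagrange cs ss) => x //; ring.
exact: W11_cst.
Qed.

(** Where [z] vanishes, the derivative of [z z1] is [z1^2], so the integral of [z1^2] over
    [[-1/2, 1/2]] is 0 and continuity gives the value at 0. *)
Lemma quasi_sol_eq0 Q z z1 : quasi_sol Q z z1 (fun=> 0) ->
  (forall x, -1 < x < 1 -> z x = 0) -> z1 0 = 0.
Proof.
move=> [Wz Wz1] z0; have cz1 := W11_cont Wz1.
have h : - (1 / 2) <= 1 / 2 :> R by lra.
have := W11_increment (W11M Wz Wz1) h.
rewrite !z0; [|by apply/andP; split; lra..].
rewrite !mul0r subrr (@eq_itv_integral _ _ (fun x => z1 x ^+ 2)) => [/esym H|x /andP[xl xr]].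
  apply/eqP; rewrite -sqrf_eq0; apply/eqP.
  apply: (continuous_integral_eq0 (continuous_sqr cz1) _ H) => [x|]; first exact: sqr_ge0.
  by apply/andP; split; lra.
by rewrite z0; [ring|apply/andP; split; lra].
Qed.

(** The derivatives of the two primitives cancel in the first equation, [c s f - s c f = 0]; in the
    second they leave [-f] times the Wronskian, which is 1. The base point is free: 0 serves for
    [w], and [-N] for a solution of compact support. *)
Lemma quasi_sol_variation Q c c1 s s1 f a :
  quasi_sol Q c c1 (fun=> 0) -> quasi_sol Q s s1 (fun=> 0) ->
  (forall x, c x * s1 x - c1 x * s x = 1) -> Lloc1 f ->
  quasi_sol Q
    (fun x => c x * prim a (fun t => s t * f t) x - s x * prim a (fun t => c t * f t) x)
    (fun x => c1 x * prim a (fun t => s t * f t) x - s1 x * prim a (fun t => c t * f t) x) f.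
Proof.
move=> [Wc Wc1] [Ws Ws1] wr If.
have P g : Lloc1 g -> W11loc_deriv (prim a g) g.
  by move=> Ig; apply: eq_W11 (W11_prim 0 a Ig) => // x; rewrite add0r.
have PA := P _ (Lloc1_contM (W11_cont Ws) If).
have PB := P _ (Lloc1_contM (W11_cont Wc) If).
split.
  by apply: eq_W11 (W11B (W11M Wc PA) (W11M Ws PB)) => x //; ring.
apply: eq_W11 (W11B (W11M Wc1 PA) (W11M Ws1 PB)) => x //.
apply/eqP; rewrite -subr_eq0.
rewrite [X in X == 0](_ : _ = f x * (1 - (c x * s1 x - c1 x * s x))); last by ring.
by rewrite wr subrr mulr0.
Qed.

(* Inverting the Gram matrix of c and s for a weight carried by [-1, 1]. *)
Lemma dual_functions Q c c1 s s1 :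
  quasi_sol Q c c1 (fun=> 0) -> quasi_sol Q s s1 (fun=> 0) ->
  c 0 = 1 /\ c1 0 = 0 -> s 0 = 0 /\ s1 0 = 1 ->
  exists phi psi : R -> R, [/\ continuous phi, continuous psi,
    (forall x, 1 <= `|x| -> phi x = 0) /\ (forall x, 1 <= `|x| -> psi x = 0),
    Rintegral mu `[-1, 1] (fun x => phi x * c x) = 1 /\
    Rintegral mu `[-1, 1] (fun x => phi x * s x) = 0 &
    Rintegral mu `[-1, 1] (fun x => psi x * c x) = 0 /\
    Rintegral mu `[-1, 1] (fun x => psi x * s x) = 1].
Proof.
move=> cS sS [c0 c10] [s0 s10].
have cc := W11_cont cS.1; have cs := W11_cont sS.1.
pose k := bump 1.
have ck : continuous k by exact: bump_continuous.
have c3 (p q : R -> R) : continuous p -> continuous q -> continuous (fun x => k x * (p x * q x)).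
  by move=> cp cq x; apply: cvgM; [exact: ck|apply: cvgM; [exact: cp|exact: cq]].
pose G p q := Rintegral mu `[-1, 1] (fun x => k x * (p x * q x)).
pose comb al be x := k x * (al * c x + be * s x).
have combE (p : R -> R) al be : continuous p ->
    Rintegral mu `[-1, 1] (fun x => comb al be x * p x) = al * G c p + be * G s p.
  move=> cp; have I1 := Lloc1_cont (c3 _ _ cc cp); have I2 := Lloc1_cont (c3 _ _ cs cp).
  rewrite -!itv_integralZ// -itv_integralD; [|exact: Lloc1Z|exact: Lloc1Z].
  by apply: eq_itv_integral => x _; rewrite /comb; ring.
have lin al be : continuous (fun x => al * c x + be * s x).
  by move=> x; apply: cvgD; apply: cvgM; try exact: cvg_cst; [exact: cc|exact: cs].
have ccomb al be : continuous (comb al be).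
  by move=> x; apply: cvgM; [exact: ck|exact: lin].
have comb0 al be x : 1 <= `|x| -> comb al be x = 0.
  by move=> x1; rewrite /comb /k bump_eq0// mul0r.
have Gsc : G s c = G c s by apply: eq_itv_integral => x _; ring.
(* A null vector of the quadratic form gives [z = x c + y s] with weighted square integral 0, so [z]
   vanishes on []-1, 1[]; its value at 0 is [x] and that of its quasi-derivative is [y]. *)
have nondeg x y : x ^+ 2 * G c c + 2 * x * y * G c s + y ^+ 2 * G s s = 0 -> x = 0 /\ y = 0.
  move=> H; pose z t := x * c t + y * s t.
  have zS : quasi_sol Q z (fun t => x * c1 t + y * s1 t) (fun=> 0).
    apply: eq_quasi_sol (quasi_solD (quasi_solZ x cS) (quasi_solZ y sS)) => t.
    by ring.
  have cz : continuous z := W11_cont zS.1.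
  have IG (p q : R -> R) : continuous p -> continuous q -> Lloc1 (fun x => k x * (p x * q x)).
    by move=> cp cq; apply: Lloc1_cont; exact: c3.
  have Gz : G z z = 0.
    rewrite -[RHS]H /G -!itv_integralZ; try exact: IG.
    rewrite -!itv_integralD; try (by apply: Lloc1Z; exact: IG); last first.
      by apply: Lloc1D; apply: Lloc1Z; exact: IG.
    by apply: eq_itv_integral => t _; rewrite /z; ring.
  have z0 t : -1 < t < 1 -> z t = 0.
    move=> t1; have kt : 0 < k t by apply: bump_gt0; rewrite ltr_norml.
    have /eqP : k t * (z t * z t) = 0.
      apply: (continuous_integral_eq0 (c3 _ _ cz cz) _ Gz t1) => r.
      by rewrite mulr_ge0 ?bump_ge0// -expr2 sqr_ge0.
    by rewrite !mulf_eq0 (gt_eqF kt) orbb => /eqP.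
  have := quasi_sol_eq0 zS z0; rewrite c10 s10 mulr0 add0r mulr1 => ->.
  have : z 0 = 0 by apply: z0; apply/andP; split; lra.
  by rewrite /z c0 s0 mulr1 mulr0 addr0.
have g22 : G s s != 0.
  apply/eqP => H; have [] := nondeg 0 1; first by rewrite H; ring.
  by move=> _ /eqP; rewrite oner_eq0.
have det : G c c * G s s - G c s ^+ 2 != 0.
  (* At [(G s s, - G c s)] the form equals [G s s] times the determinant. *)
  apply/eqP => H; have [] := nondeg (G s s) (- G c s); last by move=> /eqP; rewrite (negbTE g22).
  rewrite -[RHS](mulr0 (G s s)) -H; ring.
set D := G c c * G s s - G c s ^+ 2 in det.
exists (comb (G s s / D) (- G c s / D)), (comb (- G c s / D) (G c c / D)).
split; [exact: ccomb|exact: ccomb|by split=> x; exact: comb0| |];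
  split; rewrite combE// ?Gsc /D; field; exact: det.
Qed.

Lemma adjoint_SmaxR Q v w : measurable_fun setT Q -> Lloc1 (fun x => Q x ^+ 2) ->
  L2 v -> L2 w ->
  (forall u f, SmaxR Q u f ->
    Rintegral mu setT (fun x => f x * v x) = Rintegral mu setT (fun x => u x * w x)) ->
  SmaxR Q v w.
Proof.
move=> mQ IQ2 Lv Lw H; have IQ := Lloc1_sqr mQ IQ2.
have [c [c1 [s [s1 [cS sS c0 s0 wr]]]]] := quasi_sol_fundamental IQ IQ2.
have cc := W11_cont cS.1; have cs := W11_cont sS.1.
have Lv' := L2_L2loc Lv; have Iw := L2loc_Lloc1 (L2_L2loc Lw).
pose vt x := c x * prim 0 (fun t => s t * w t) x - s x * prim 0 (fun t => c t * w t) x.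
pose p x := c1 x * prim 0 (fun t => s t * w t) x - s1 x * prim 0 (fun t => c t * w t) x.
have vS : quasi_sol Q vt p w by exact: quasi_sol_variation.
have cvt := W11_cont vS.1.
pose h x := v x - vt x.
have Lh : L2loc h by apply: L2locB => //; exact: L2loc_cont.
(* A compactly supported [f] orthogonal to [c] and [s] is the image of some [u] in the domain, and
   its pairings with [v] and [vt] both equal that of [u] with [w]. *)
have test N f : 0 < N -> L2loc f -> (forall x, N <= `|x| -> f x = 0) ->
    Rintegral mu `[- N, N] (fun x => f x * c x) = 0 ->
    Rintegral mu `[- N, N] (fun x => f x * s x) = 0 ->
    Rintegral mu `[- N, N] (fun x => f x * h x) = 0.
  move=> N0 Lf f0 fc fs; have If := L2loc_Lloc1 Lf.
  have Icf := Lloc1_contM cc If; have Isf := Lloc1_contM cs If.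
  (* Integrating from [-N] makes [A] and [B] vanish outside [[-N, N]], on the right by the two
     orthogonality relations; hence [u] has compact support. *)
  pose A := prim (- N) (fun t => s t * f t); pose B := prim (- N) (fun t => c t * f t).
  have A0 x : N <= `|x| -> A x = 0.
    apply: prim_supp_eq0 => //; [|exact: ltW|].
      by move=> y yN; rewrite f0// mulr0.
    by rewrite -[RHS]fs; apply: eq_itv_integral => y _; rewrite mulrC.
  have B0 x : N <= `|x| -> B x = 0.
    apply: prim_supp_eq0 => //; [|exact: ltW|].
      by move=> y yN; rewrite f0// mulr0.
    by rewrite -[RHS]fc; apply: eq_itv_integral => y _; rewrite mulrC.
  pose u x := c x * A x - s x * B x; pose u1 x := c1 x * A x - s1 x * B x.
  have uS : quasi_sol Q u u1 f by exact: quasi_sol_variation.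
  have cu := W11_cont uS.1.
  have u0 x : N <= `|x| -> u x = 0 by move=> xN; rewrite /u A0// B0// !mulr0 subrr.
  have u10 x : N <= `|x| -> u1 x = 0 by move=> xN; rewrite /u1 A0// B0// !mulr0 subrr.
  have Lu : L2 u by apply: L2_supp u0; exact: L2loc_cont.
  have Lf' : L2 f by exact: L2_supp f0.
  have := H u f (quasi_sol_SmaxR Lu Lf' (aeW _ (fun=> erefl)) uS).
  have Ifv : Lloc1 (fun x => f x * v x) by exact: L2loc_mul.
  have Iuw : Lloc1 (fun x => u x * w x) by exact: Lloc1_contM.
  have fv0 x : N <= `|x| -> f x * v x = 0 by move=> xN; rewrite f0// mul0r.
  have uw0 x : N <= `|x| -> u x * w x = 0 by move=> xN; rewrite u0// mul0r.
  have [_ ->] := integral_supp Ifv fv0.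
  have [_ ->] := integral_supp Iuw uw0.
  have NN : - N <= N by lra.
  have nN : N <= `|N| by exact: ler_norm.
  have nN' : N <= `|- N| by rewrite normrN.
  (* [u] and its quasi-derivative vanish at the end points, so there are no boundary terms although
     [vt] is not known to decay. *)
  have := W11_increment (quasi_sol_lagrange uS vS) NN.
  rewrite !u0// !u10// !mul0r subrr => E1 E2.
  have Ifvt : Lloc1 (fun x => f x * vt x) by apply: L2loc_mul => //; exact: L2loc_cont.
  have E3 : Rintegral mu `[- N, N] (fun x => f x * vt x) =
      Rintegral mu `[- N, N] (fun x => u x * w x).
    apply/eqP; rewrite -subr_eq0; apply/eqP; rewrite [RHS]E1.
    by rewrite itv_integralD ?itv_integralN//; exact: Lloc1N.
  have -> : Rintegral mu `[- N, N] (fun x => f x * h x) =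
      Rintegral mu `[- N, N] (fun x => f x * v x + -1 * (f x * vt x)).
    by apply: eq_itv_integral => x _; rewrite /h; ring.
  rewrite itv_integralD ?itv_integralZ//; last exact: Lloc1Z.
  by rewrite E2 E3 mulN1r subrr.
have [phi [psi [cphi cpsi [phi0 psi0] [phic phis] [psic psis]]]] := dual_functions cS sS c0 s0.
(* If [h = al c + be s], pairing with the dual functions [phi] and [psi] yields exactly these
   coefficients. *)
pose al := Rintegral mu `[-1, 1] (fun x => phi x * h x).
pose be := Rintegral mu `[-1, 1] (fun x => psi x * h x).
pose k x := h x - (al * c x + be * s x).
have clin : continuous (fun x => al * c x + be * s x).
  by move=> x; apply: cvgD; apply: cvgM; try exact: cvg_cst; [exact: cc|exact: cs].
have Lk : L2loc k by apply: L2locB => //; exact: L2loc_cont.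
have Lc := L2loc_cont cc; have Ls := L2loc_cont cs.
have Lphi := L2loc_cont cphi; have Lpsi := L2loc_cont cpsi.
have ortho N F : 1 <= N -> L2loc F -> (forall x, N <= `|x| -> F x = 0) ->
    Rintegral mu `[- N, N] (fun x => F x * k x) = 0.
  move=> N1 LF F0.
  pose a := Rintegral mu `[- N, N] (fun x => F x * c x).
  pose b := Rintegral mu `[- N, N] (fun x => F x * s x).
  (* Subtracting multiples of the dual functions makes an arbitrary [F] orthogonal to [c] and
     [s]. *)
  pose f x := F x - a * phi x - b * psi x.
  have Lf : L2loc f by apply: L2locB; [apply: L2locB => //|]; exact: L2locZ.
  have f0 x : N <= `|x| -> f x = 0.
    by move=> xN; rewrite /f F0// phi0 ?psi0 ?(le_trans N1)//; ring.
  have fE q : L2loc q -> Rintegral mu `[- N, N] (fun x => f x * q x) =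
      Rintegral mu `[- N, N] (fun x => F x * q x)
      - a * Rintegral mu `[-1, 1] (fun x => phi x * q x)
      - b * Rintegral mu `[-1, 1] (fun x => psi x * q x).
    move=> Lq; have I1 := L2loc_mul LF Lq.
    have I2 := L2loc_mul Lphi Lq; have I3 := L2loc_mul Lpsi Lq.
    rewrite -(itv_integral_supp I2 _ N1); last by move=> x x1; rewrite phi0// mul0r.
    rewrite -(itv_integral_supp I3 _ N1); last by move=> x x1; rewrite psi0// mul0r.
    rewrite -!mulNr -!itv_integralZ// -!itv_integralD//; try exact: Lloc1Z.
      by apply: eq_itv_integral => x _; rewrite /f; ring.
    by apply: Lloc1D => //; exact: Lloc1Z.
  have N0 : 0 < N by lra.
  have := test N f N0 Lf f0; rewrite !fE// phic phis psic psis.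
  rewrite !mulr0 !mulr1 !subr0 !subrr => /(_ erefl erefl).
  have -> : Rintegral mu `[- N, N] (fun x => F x * k x) =
     Rintegral mu `[- N, N] (fun x => F x * h x) - (al * a + be * b).
    have I1 := L2loc_mul LF Lh; have I2 := L2loc_mul LF Lc; have I3 := L2loc_mul LF Ls.
    rewrite opprD -!mulNr -!itv_integralZ// -!itv_integralD//; try exact: Lloc1Z.
      by apply: eq_itv_integral => x _; rewrite /k; ring.
    by apply: Lloc1D; exact: Lloc1Z.
  by rewrite -/al -/be => E; rewrite -[RHS]E; ring.
(* With [F] equal to [bump] times [k], the weighted integral of [k^2] is 0 for every integer radius;
   countably many null sets are united. *)
have kae : {ae mu, forall x, forall n, bump n.+1%:R x * k x * k x = 0}.
  apply: ae_foralln => n.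
  have Lbk := L2loc_contM (@bump_continuous n.+1%:R) Lk.
  have z0 x : n.+1%:R <= `|x| -> bump n.+1%:R x * k x = 0.
    by move=> xn; rewrite bump_eq0// mul0r.
  have zk0 x : n.+1%:R <= `|x| -> bump n.+1%:R x * k x * k x = 0.
    by move=> xn; rewrite z0// mul0r.
  have [Iz zE] := integral_supp (L2loc_mul Lbk Lk) zk0.
  apply: ae_eq0_of_integral => //.
    by move=> x; rewrite -mulrA mulr_ge0 ?bump_ge0// -expr2 sqr_ge0.
  by rewrite zE ortho// ler1n.
have vE : {ae mu, forall x, v x = vt x + (al * c x + be * s x)}.
  (* The radius [truncn |x| + 1] exceeds [|x|], so the weight is positive at [x] and [k x = 0]. *)
  apply: ae_imply kae => x /(_ (Num.truncn `|x|)) /eqP.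
  rewrite -mulrA !mulf_eq0 orbb gt_eqF ?bump_gt0 ?truncnS_gt//= => /eqP.
  by rewrite /k /h; lra.
apply: (quasi_sol_SmaxR Lv Lw vE (v := fun x => p x + (al * c1 x + be * s1 x))).
apply: eq_quasi_sol (quasi_solD vS (quasi_solD (quasi_solZ al cS) (quasi_solZ be sS))) => x.
by ring.
Qed.

End adjoint.

(** * From real-valued to complex-valued functions *)

Section SmaxR_facts.
Variable R : realType.
Local Notation mu := (@lebesgue_measure R).

(** Allows a real pair [(u, f)] to be tested as a complex pair with vanishing imaginary part. *)
Lemma SmaxR0 (Q : R -> R) : SmaxR Q (fun=> 0) (fun=> 0).
Proof.
have L0 : L2 (fun=> 0 : R).
  by apply: (@L2_supp R _ 0) => //; apply: L2loc_cont => x; exact: cvg_cst.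
apply: (@quasi_sol_SmaxR R Q (fun=> 0) (fun=> 0) (fun=> 0)) => //; first exact: aeW.
by split; apply: eq_W11 (W11_cst 0) => x //; ring.
Qed.

Lemma RintegralD_mul (f g v w : R -> R) : L2 f -> L2 v -> L2 g -> L2 w ->
  Rintegral mu setT (fun x => f x * v x + g x * w x) =
  Rintegral mu setT (fun x => f x * v x) + Rintegral mu setT (fun x => g x * w x).
Proof. by move=> Lf Lv Lg Lw; rewrite RintegralD//; exact: L2_mul. Qed.

Lemma RintegralB_mul (f g v w : R -> R) : L2 f -> L2 v -> L2 g -> L2 w ->
  Rintegral mu setT (fun x => f x * v x - g x * w x) =
  Rintegral mu setT (fun x => f x * v x) - Rintegral mu setT (fun x => g x * w x).
Proof. by move=> Lf Lv Lg Lw; rewrite RintegralB//; exact: L2_mul. Qed.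

Lemma Rintegral_mul0l (f : R -> R) : Rintegral mu setT (fun x => 0 * f x) = 0.
Proof.
rewrite (_ : (fun _ => _) = (fun=> 0)); last by apply/funext => x; rewrite mul0r.
by rewrite /Rintegral integral0.
Qed.

End SmaxR_facts.

Theorem theorem3p10 (R : realType) (Q : R -> R)
  (Qmeas : measurable_fun setT Q)
  (Qper : forall x : R, Q (x + 1) = Q x)
  (QL2 : (@lebesgue_measure R).-integrable `[0, 1] (fun x => ((Q x) ^+ 2)%:E))
  (Qmean0 : Rintegral (@lebesgue_measure R) `[0, 1] Q = 0) :
  selfadjointC (Smax Q).
Proof.
have mQ2 : measurable_fun setT (fun x => Q x ^+ 2) by exact: measurable_funX.
have Q2ge0 x : 0 <= Q x ^+ 2 by exact: sqr_ge0.
have Q2per x : Q (x + 1) ^+ 2 = Q x ^+ 2 by rewrite Qper.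
have IQ2 : Lloc1 (fun x => Q x ^+ 2) := periodic_Lloc1 mQ2 Q2ge0 Q2per QL2.
pose K := Rintegral (@lebesgue_measure R) `[0, 1] (fun x => Q x ^+ 2).
have K0 : 0 <= K by exact: itv_integral_ge0.
have QK := periodic_integral_le mQ2 Q2ge0 Q2per QL2.
have sym := SmaxR_symmetric K0 Qmeas IQ2 QK.
move=> v w; split=> [[[Lv1 Lv2] [[Lw1 Lw2] vw]]|[S1 S2]].
  (* Tested with [(u, 0)] and [(f, 0)], the complex identity splits: its real part involves [v.1]
     and [w.1], its imaginary part, up to sign, [v.2] and [w.2]. *)
  have real u f : SmaxR Q u f ->
      Rintegral (@lebesgue_measure R) setT (fun x => f x * v.1 x) =
      Rintegral (@lebesgue_measure R) setT (fun x => u x * w.1 x) /\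
      Rintegral (@lebesgue_measure R) setT (fun x => f x * v.2 x) =
      Rintegral (@lebesgue_measure R) setT (fun x => u x * w.2 x).
    move=> Suf; have S0 := SmaxR0 Q.
    have [Lu [Lf _]] := Suf; have [L0 _] := S0.
    have := vw (u, fun=> 0) (f, fun=> 0) (conj Suf S0).
    rewrite /innerC/= !RintegralD_mul// !RintegralB_mul// !Rintegral_mul0l !addr0 !sub0r.
    by case=> -> /oppr_inj ->.
  by split; apply: adjoint_SmaxR => // u f /real[].
have [Lv1 [Lw1 _]] := S1; have [Lv2 [Lw2 _]] := S2.
split=> //; split=> // u f [Su1 Su2].
have [Lu1 [Lf1 _]] := Su1; have [Lu2 [Lf2 _]] := Su2.
(* The two components of the inner product combine four real pairings, to each of which the symmetry
   of the real operator applies. *)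
rewrite /innerC !RintegralD_mul// !RintegralB_mul//.
by rewrite (sym _ _ _ _ Su1 S1) (sym _ _ _ _ Su2 S2) (sym _ _ _ _ Su2 S1) (sym _ _ _ _ Su1 S2).
Qed.
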